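(* Let $K$ be a field of characteristic zero, let $a,b\ge 1$ be integers, and let $R=K[x_iy_j : 0\le i\le a,\ 0\le j\le b]\subseteq K[x_0,\dots,x_a,y_0,\dots,y_b]$ be the coordinate ring of $\mathbb{P}^a\times\mathbb{P}^b$ via the Segre embedding, $\mathbb{N}$-graded so that each $x_iy_j$ is homogeneous of degree $1$. Then Bernstein's inequality holds for $D_R=D_{R|K}$: for every Bernstein filtration $\mathcal{B}^\bullet$ on $D_R$ and every nonzero left $D_R$-module $M$, one has $\operatorname{Dim}(M)\ge\dim(R)$, where $\operatorname{Dim}(M)=\inf\{\operatorname{Dim}(\mathcal{F}^\bullet) : \mathcal{F}^\bullet \text{ is a filtration on } M \text{ compatible with } \mathcal{B}^\bullet\}$ and $\dim(R)$ is the Krull dimension.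
   Context: Differential operators: for a commutative $K$-algebra $R$, $D_{R|K}\subseteq \operatorname{End}_K(R)$ is the ring of $K$-linear differential operators: $D^0_{R|K}$ is the set of multiplication operators by elements of $R$ (identified with $R$), $D^{n+1}_{R|K}=\{\delta\in\operatorname{End}_K(R): [\delta,r]\in D^n_{R|K}\text{ for all } r\in R\}$, and $D_{R|K}=\bigcup_n D^n_{R|K}$, with composition as product. The order $\operatorname{ord}(\delta)$ is the least $n$ with $\delta\in D^n_{R|K}$. Bernstein filtration (for a finitely generated $\mathbb{N}$-graded $K$-algebra $R$ with $R_0=K$): an operator $\delta$ is homogeneous of degree $d$ if $\delta([R]_j)\subseteq [R]_{j+d}$ for all $j$. For an integer $w$ such that $R$ is generated as a $K$-algebra by homogeneous elements of degree strictly less than $w$, the Bernstein filtration with slope $w$ on $D_{R|K}$ is $B^i=K\text{-span}\{\delta\text{ homogeneous}: \deg(\delta)+w\operatorname{ord}(\delta)\le i\}$, $i\ge0$. A Bernstein filtration is one of these for some such $w$. Compatible filtration: a filtration on a left $D_R$-module $M$ compatible with $\mathcal{B}^\bullet$ is an ascending sequence of $K$-subspaces $F^0\subseteq F^1\subseteq\cdots$ of $M$ with $\bigcup_i F^i=M$ and $B^iF^j\subseteq F^{i+j}$ for all $i,j$. Its dimension is $\operatorname{Dim}(\mathcal{F}^\bullet)=\inf\{t\in\mathbb{R}_{\ge0}: \lim_{n\to\infty}\dim_K(F^n)/n^t=0\}$ (equal to $\infty$ if there is no such $t$). *)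

(* Defs.v *)
From HB Require Import structures.
From mathcomp Require Import all_boot all_order all_algebra.
From mathcomp Require Import mpoly.
From mathcomp Require Import all_classical all_reals.
From mathcomp Require Import ereal topology normedtype sequences exp.

Set Implicit Arguments.
Unset Strict Implicit.
Unset Printing Implicit Defensive.

Import Order.TTheory GRing.Theory Num.Theory.
Import numFieldNormedType.Exports.

Local Open Scope classical_set_scope.
Local Open Scope ring_scope.

Section LinearAlgebra.
Variables (K : fieldType) (V : lmodType K).

Definition lspan (S : set V) : set V :=
  [set v | exists n (c : 'I_n -> K) (u : 'I_n -> V),
    (forall i, S (u i)) /\ v = \sum_(i < n) c i *: u i].

Definition lin_indep n (u : 'I_n -> V) : Prop :=
  forall c : 'I_n -> K, \sum_(i < n) c i *: u i = 0 -> forall i, c i = 0.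

(* The dimension of a subspace that may be infinite-dimensional, in which case
   the value is +oo. *)
Definition edim (RR : realType) (F : set V) : \bar RR :=
  ereal_sup [set n%:R%:E | n in
    [set n : nat | exists u : 'I_n -> V, (forall i, F (u i)) /\ lin_indep u]].

End LinearAlgebra.

Definition gen_subalg (K : fieldType) (A : algType K) (S : set A) : set A :=
  [set x | forall B : {pred A},
    subalg_closed B -> (forall s, S s -> s \in B) -> x \in B].

Lemma gen_subalg_closed (K : fieldType) (A : algType K) (S : set A) :
  subalg_closed (mem (gen_subalg S)).
Proof.
split; first by rewrite inE => B [].
- move=> c u v; rewrite !inE => Su Sv B cB SB; case: (cB) => _ lB _.
  by apply: lB; [apply: Su | apply: Sv].
- move=> u v; rewrite !inE => Su Sv B cB SB; case: (cB) => _ _ mB.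
  by apply: mB; [apply: Su | apply: Sv].
Qed.

Lemma gen_subalg_gen (K : fieldType) (A : algType K) (S : set A) x :
  S x -> x \in gen_subalg S.
Proof. by move=> Sx; rewrite inE => B _; apply. Qed.

(* A chain P_0 < ... < P_n of primes has length n.  [idealr_closed] includes
   properness. *)
Definition prime_ideal (R : comNzRingType) (P : {pred R}) : Prop :=
  idealr_closed P /\ prime_idealr_closed P.

Definition krull_dim (RR : realType) (R : comNzRingType) : \bar RR :=
  ereal_sup [set n%:R%:E | n in
    [set n : nat | exists P : nat -> {pred R},
      (forall i, (i <= n)%N -> prime_ideal (P i)) /\
      (forall i, (i < n)%N ->
         {subset P i <= P i.+1} /\ ~ {subset P i.+1 <= P i})]].

Section DifferentialOperators.
Variables (K : fieldType) (R : comAlgType K).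
Implicit Types (f g : R -> R) (n m : nat).

Fixpoint diffop_le n f : Prop :=
  if n is n'.+1 then
    linear f /\ forall r, diffop_le n' (fun x => f (r * x) - r * f x)
  else exists r, forall x, f x = r * x.

Lemma diffop_le_linear n f : diffop_le n f -> linear f.
Proof.
case: n => [[r fE]|n [] //] c x y.
by rewrite !fE mulrDr scalerAr.
Qed.

Lemma eq_diffop_le n f g : f =1 g -> diffop_le n f -> diffop_le n g.
Proof. by move=> /funext ->. Qed.

Lemma diffop_leS n f : diffop_le n f -> diffop_le n.+1 f.
Proof.
elim: n f => [|n IHn] f fn; split; try exact: diffop_le_linear fn.
- move=> r; case: fn => s fE; exists 0 => x.
  by rewrite !fE mul0r mulrCA subrr.
- by move=> r; apply: IHn; case: fn => _; apply.
Qed.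

Lemma diffop_le_leq n m f : (n <= m)%N -> diffop_le n f -> diffop_le m f.
Proof.
move=> /subnK <-; elim: (m - n)%N => [//|k IHk] fn.
by rewrite addSn; apply/diffop_leS/IHk.
Qed.

Lemma diffop_le_lin n c f g :
  diffop_le n f -> diffop_le n g -> diffop_le n (fun x => c *: f x + g x).
Proof.
elim: n f g => [|n IHn] f g.
  move=> [r fE] [s gE]; exists (c *: r + s) => x.
  by rewrite fE gE mulrDl scalerAl.
move=> [lf fn] [lg gn]; split.
  move=> k x y; rewrite lf lg !scalerDr !scalerA (mulrC c k) -!addrA.
  by congr (_ + _); rewrite addrCA.
move=> r; apply: eq_diffop_le (IHn _ _ (fn r) (gn r)) => x.
rewrite scalerBr mulrDr scalerAr opprD -!addrA; congr (_ + _).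
by rewrite addrCA.
Qed.

Lemma diffop_leD n f g :
  diffop_le n f -> diffop_le n g -> diffop_le n (fun x => f x + g x).
Proof.
by move=> fn gn; apply: eq_diffop_le (diffop_le_lin 1 fn gn) => x; rewrite scale1r.
Qed.

Lemma linear_funB f : linear f -> {morph f : x y / x - y}.
Proof. by move=> lf x y; rewrite -[- y]scaleN1r addrC lf scaleN1r addrC. Qed.

Lemma diffop_le_comp n m f g :
  diffop_le n f -> diffop_le m g -> diffop_le (n + m) (f \o g).
Proof.
have [k] := ubnP (n + m); elim: k n m f g => // k IHk n m f g ltk fn gm.
have lf := diffop_le_linear fn; have lg := diffop_le_linear gm.
have lfg : linear (f \o g) by move=> c x y /=; rewrite lg lf.
case: n m => [|n] [|m] in fn gm ltk *.
- case: fn => r fE; case: gm => s gE; exists (r * s) => x /=.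
  by rewrite fE gE mulrA.
- split=> // r; apply: eq_diffop_le (IHk 0%N m f _ _ fn (gm.2 r)) => //.
  by move=> x /=; case: fn => s fE; rewrite !fE mulrBr (mulrCA s).
- rewrite addn0; split=> // r.
  rewrite -[n]addn0; apply: eq_diffop_le (IHk n 0%N _ g _ (fn.2 r) gm) => //.
  by move=> x /=; case: gm => s gE; rewrite !gE (mulrCA s).
- rewrite addSn; split=> // r.
  apply: eq_diffop_le (diffop_leD (f := f \o (fun x => g (r * x) - r * g x))
    (g := (fun x => f (r * x) - r * f x) \o g) _ _).
  + by move=> x /=; rewrite (linear_funB lf) addrA subrK.
  + by rewrite addnS -addSn; apply: IHk fn (gm.2 r); move: ltk; rewrite !addSn !addnS.
  + by apply: IHk (fn.2 r) gm; move: ltk; rewrite !addSn.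
Qed.

Record diffop := Diffop {
  diffop_fun :> R -> R;
  diffopP : `[< exists n, diffop_le n diffop_fun >] }.

HB.instance Definition _ := [isSub for diffop_fun].
HB.instance Definition _ := [Choice of diffop by <:].

Lemma diffop_submod_closed :
  GRing.subsemimod_closed (fun f : R -> R => `[< exists n, diffop_le n f >]).
Proof.
apply: GRing.submod_closed_semi; split.
  by apply/asboolP; exists 0%N, 0 => x; rewrite mul0r.
move=> c f g /asboolP[n fn] /asboolP[m gm]; apply/asboolP; exists (maxn n m).
by apply: diffop_le_lin;
  [apply: diffop_le_leq fn; apply: leq_maxl |
   apply: diffop_le_leq gm; apply: leq_maxr].
Qed.

HB.instance Definition _ :=
  GRing.SubChoice_isSubLmodule.Build K (R -> R) _ diffop diffop_submod_closed.

Lemma diffop_linear (d : diffop) : linear d.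
Proof. by case/asboolP: (diffopP d) => n; apply: diffop_le_linear. Qed.

Lemma diffop_one_subproof : `[< exists n, diffop_le n (@id R) >].
Proof. by apply/asboolP; exists 0%N, 1 => x; rewrite mul1r. Qed.

Lemma diffop_mul_subproof (d e : diffop) :
  `[< exists n, diffop_le n (d \o e) >].
Proof.
case/asboolP: (diffopP d) => n dn; case/asboolP: (diffopP e) => m em.
by apply/asboolP; exists (n + m)%N; apply: diffop_le_comp.
Qed.

Definition diffop_one := Diffop diffop_one_subproof.
Definition diffop_mul (d e : diffop) := Diffop (diffop_mul_subproof d e).

Lemma diffop_eqP (d e : diffop) : d =1 e -> d = e.
Proof. by move=> de; apply/val_inj/funext. Qed.

Lemma diffop_mulA : associative diffop_mul.
Proof. by move=> d e f; apply: diffop_eqP. Qed.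
Lemma diffop_mul1 : left_id diffop_one diffop_mul.
Proof. by move=> d; apply: diffop_eqP. Qed.
Lemma diffop_mulr1 : right_id diffop_one diffop_mul.
Proof. by move=> d; apply: diffop_eqP. Qed.
Lemma diffop_mulDl : left_distributive diffop_mul +%R.
Proof. by move=> d e f; apply: diffop_eqP. Qed.
Lemma diffop_mulDr : right_distributive diffop_mul +%R.
Proof.
move=> d e f; apply: diffop_eqP => x.
have := diffop_linear d 1 (e x) (f x).
by rewrite !scale1r.
Qed.
Lemma diffop_one_neq0 : diffop_one != 0.
Proof.
apply/eqP => /(congr1 (fun d : diffop => d 1)) E.
by have /eqP := E; rewrite [_ == _](oner_eq0 R).
Qed.

HB.instance Definition _ := GRing.Zmodule_isNzRing.Build diffop
  diffop_mulA diffop_mul1 diffop_mulr1 diffop_mulDl diffop_mulDr diffop_one_neq0.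

Lemma diffop_scaleAl (c : K) (d e : diffop) : c *: (d * e) = (c *: d) * e.
Proof. by apply: diffop_eqP. Qed.
HB.instance Definition _ :=
  GRing.Lmodule_isLalgebra.Build K diffop diffop_scaleAl.

Lemma diffop_scaleAr (c : K) (d e : diffop) : c *: (d * e) = d * (c *: e).
Proof.
apply: diffop_eqP => x; have := diffop_linear d c (e x) 0.
rewrite !addr0 (_ : d 0 = 0) ?addr0 => [/esym //|].
by have := diffop_linear d (-1) 0 0; rewrite scaler0 addr0 scaleN1r addNr.
Qed.
HB.instance Definition _ :=
  GRing.Lalgebra_isAlgebra.Build K diffop diffop_scaleAr.

Lemma diffop_ord_subproof (d : diffop) :
  exists n, `[< diffop_le n d >].
Proof. by case/asboolP: (diffopP d) => n dn; exists n; apply/asboolP. Qed.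

Definition diffop_ord (d : diffop) : nat := ex_minn (diffop_ord_subproof d).

End DifferentialOperators.

Section BernsteinFiltration.
Variables (K : fieldType) (R : comAlgType K).
Variable G : nat -> set R.  (* G j is the degree j component of R *)

Definition int_piece (j : int) : set R :=
  if j is Posz n then G n else [set 0].

Definition diffop_homog (deg : int) (d : diffop R) : Prop :=
  forall (j : nat) (r : R), G j r -> int_piece (j%:Z + deg) (d r).

Definition bernstein_slope (w : int) : Prop :=
  exists S : set R, (forall s, S s -> exists2 j : nat, j%:Z < w & G j s) /\
    (forall r, gen_subalg S r).

(* The degree of a nonzero homogeneous operator is unique; 0 is homogeneous of
   every degree but lies in every span. *)
Definition bernstein (w : int) (i : nat) : set (diffop R) :=
  lspan [set d | exists deg : int,
    diffop_homog deg d /\ deg + w * (diffop_ord d)%:Z <= i%:Z].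

Definition bernstein_filtration (B : nat -> set (diffop R)) : Prop :=
  exists w : int, bernstein_slope w /\ B = bernstein w.

End BernsteinFiltration.

Definition restr_scalars (K : fieldType) (A : algType K) (M : lmodType A) : Type :=
  M.

Section RestrictScalars.
Variables (K : fieldType) (A : algType K) (M : lmodType A).
Local Notation MK := (restr_scalars M).

HB.instance Definition _ := GRing.Zmodule.copy MK M.

Definition restr_scale (c : K) (m : MK) : MK := (c%:A : A) *: (m : M).

Lemma restr_scalerA (a b : K) (v : MK) :
  restr_scale a (restr_scale b v) = restr_scale (a * b) v.
Proof. by rewrite /restr_scale scalerA -scalerAl mul1r scalerA. Qed.
Lemma restr_scale1r : left_id 1 restr_scale.
Proof. by move=> v; rewrite /restr_scale !scale1r. Qed.
Lemma restr_scalerDr : right_distributive restr_scale +%R.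
Proof. by move=> c u v; rewrite /restr_scale scalerDr. Qed.
Lemma restr_scalerDl (v : MK) : {morph restr_scale^~ v : a b / a + b}.
Proof. by move=> a b; rewrite /restr_scale !scalerDl. Qed.

HB.instance Definition _ := GRing.Zmodule_isLmodule.Build K MK
  restr_scalerA restr_scale1r restr_scalerDr restr_scalerDl.

End RestrictScalars.

Section DimensionOfModules.
Variables (RR : realType) (K : fieldType) (R : comAlgType K).
Variables (B : nat -> set (diffop R)) (M : lmodType (diffop R)).

Definition compatible_filtration (F : nat -> set M) : Prop :=
  [/\ forall n, submod_closed (mem (F n : set (restr_scalars M))),
      forall n, F n `<=` F n.+1,
      forall m, exists n, F n m
    & forall i j d m, B i d -> F j m -> F (i + j)%N (d *: m)].

(* [ereal_inf] of the empty set is +oo. *)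
Definition filtration_dim (F : nat -> set M) : \bar RR :=
  ereal_inf [set t%:E | t in
    [set t : RR | 0 <= t /\
      (fun n : nat => edim RR (F n : set (restr_scalars M))
                        * ((n%:R `^ t)^-1)%:E)%E @ \oo --> 0%E]].

Definition module_dim : \bar RR :=
  ereal_inf [set filtration_dim F | F in compatible_filtration].

End DimensionOfModules.

Section SegreRing.
Variables (K : fieldType) (a b : nat).

(* The variables are x_0, ..., x_a, y_0, ..., y_b, in this order. *)
Definition segre_mon (i : 'I_a.+1) (j : 'I_b.+1) : {mpoly K[a.+1 + b.+1]} :=
  'X_(lshift b.+1 i) * 'X_(rshift a.+1 j).

Definition segre_mons : set {mpoly K[a.+1 + b.+1]} :=
  [set p | exists i j, p = segre_mon i j].

Record segre_ring := SegreRing {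
  segre_val :> {mpoly K[a.+1 + b.+1]};
  segre_valP : segre_val \in gen_subalg segre_mons }.

HB.instance Definition _ := [isSub for segre_val].
HB.instance Definition _ := [Choice of segre_ring by <:].

Lemma segre_subalg_closed :
  GRing.subsemialg_closed
    (fun p : {mpoly K[a.+1 + b.+1]} => p \in gen_subalg segre_mons).
Proof. exact/GRing.subalg_closed_semi/gen_subalg_closed. Qed.

HB.instance Definition _ := GRing.SubChoice_isSubAlgebra.Build K
  {mpoly K[a.+1 + b.+1]} _ segre_ring segre_subalg_closed.
HB.instance Definition _ := [SubNzRing_isSubComNzRing of segre_ring by <:].

Lemma segre_gen_subproof i j : segre_mon i j \in gen_subalg segre_mons.
Proof. by apply: gen_subalg_gen; exists i, j. Qed.

Definition segre_gen i j : segre_ring := SegreRing (segre_gen_subproof i j).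

Definition segre_grading (n : nat) : set segre_ring :=
  lspan [set r | exists s : 'I_n -> 'I_a.+1 * 'I_b.+1,
    r = \prod_(k < n) segre_gen (s k).1 (s k).2].

End SegreRing.

(* Main.v *)
(* Write X_kl = x_k y_l, V_kl = d/dx_k d/dy_l and E_km = x_k d/dx_m,
   E'_lm = y_l d/dy_m (below [opX], [opV], [opEx], [opEy]); these operators
   preserve R and all lie in B^c for some c, so it suffices to treat a
   filtration F that each of them raises by one step.

   Let delta <> 0 be a differential operator that kills F^J, with J large
   compared to its order and degree.  Commutators with elements of B lose only
   a bounded number of steps, and commuting with the X_kl until this is no
   longer possible makes delta the multiplication by some f <> 0 in R;
   commuting with the E_0k and E'_0l makes f a polynomial in u = x_0 y_0, of
   degree n say.  If e = [v, x] commutes with v and x then ad(v)^n x^n = n! e^n,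
   so ad(V_01)^n f is a multiple of E'_01^n, and in the same way the n-th
   powers of the V_k1, the E_pk (p <> k), and finally of all V_kl and X_kl are
   seen to kill a smaller step of F.  Hence some m1 <> 0 is killed by all X_kl;
   since V_kl X_kl = (E_kk + 1)(E'_ll + 1) there is m2 <> 0 on which
   theta = sum E_kk = sum E'_ll is a negative integer.  Applying the V_kl, which
   lower theta, gives m3 <> 0 killed by all of them, and from
   X_kl V_kl = E_kk E'_ll one gets a nonzero vector with theta both zero and
   negative, a contradiction.

   So operators of order and degree O(N) act faithfully on F^(O(N)).  They
   contain an independent family of size (N + 1)^(2d), d = a + b + 1, whence
   dim F^(CN) >= (N + 1)^d and Dim >= d.  Finally dim R <= d: elements
   f_i of P_(i+1) \ P_i, for a chain of primes P_0 < ... < P_n, are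
   algebraically independent, and the Hilbert function of R allows at most d of
   them. *)

Require Import Defs.
From HB Require Import structures.
From mathcomp Require Import all_boot all_order all_algebra.
From mathcomp Require Import mpoly.
From mathcomp Require Import all_classical all_reals.
From mathcomp Require Import ereal topology normedtype sequences exp.
From mathcomp Require Import ring zify.

Set Implicit Arguments.
Unset Strict Implicit.
Unset Printing Implicit Defensive.

Import Order.TTheory GRing.Theory Num.Theory.
Import numFieldNormedType.Exports.

Local Open Scope classical_set_scope.
Local Open Scope ring_scope.

(** * Commuting locally nilpotent operators and iterated commutators *)

Lemma diffop0 (K : fieldType) (A : comAlgType K) (d : diffop A) : d 0 = 0.
Proof. by have := linear_funB (diffop_linear d) 0 0; rewrite !subrr. Qed.

Lemma diffopZ (K : fieldType) (A : comAlgType K) (d : diffop A) c r :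
  d (c *: r) = c *: d r.
Proof. by have := diffop_linear d c r 0; rewrite diffop0 !addr0. Qed.

Lemma diffop_sumE (K : fieldType) (A : comAlgType K) (X : Type) (t : seq X)
    (d : X -> diffop A) r :
  (\sum_(x <- t) d x) r = \sum_(x <- t) d x r.
Proof.
by apply: (big_rec2 (fun (e : diffop A) p => e r = p)) => //= i x y _ <-.
Qed.

Lemma ascending_leq (T : Type) (F : nat -> set T) i k x :
  (forall n y, F n y -> F n.+1 y) -> (i <= k)%N -> F i x -> F k x.
Proof.
move=> F_le /subnKC <-; elim: (k - i)%N => [|e IHe]; rewrite ?addn0 // addnS.
by move=> /IHe/F_le.
Qed.

(* [Q] is an ascending filtration that the operators raise by at most one
   step; it records what is preserved along the word of operators. *)
Lemma common_kernel (V : zmodType) (I : finType) (T : I -> V -> V)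
    (Q : nat -> V -> Prop) (n j : nat) (v : V) :
  (forall i, T i 0 = 0) ->
  (forall i k x, T i (T k x) = T k (T i x)) ->
  (forall k x, Q k x -> Q k.+1 x) ->
  (forall i k x, Q k x -> Q k.+1 (T i x)) ->
  (forall i, iter n (T i) v = 0) ->
  v != 0 -> Q j v ->
  exists v', [/\ v' != 0, Q (j + n * #|I|)%N v' & forall i, T i v' = 0].
Proof.
move=> T0 Tcomm Qmon QT nilv vn0 Qv.
have Qm k d x : Q k x -> Q (k + d)%N x.
  by elim: d => [|d IHd]; [rewrite addn0 | rewrite addnS => /IHd/Qmon].
have iterC i k m x : iter m (T i) (T k x) = T k (iter m (T i) x).
  by elim: m => //= m ->.
(* Induction over the list of operators: the vector is replaced by its last nonzero iterate under
   the head, at a cost of at most [n] steps. The third clause carries the kernel of the head through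
   the tail. *)
suff [v' [v'0 Qv' _ Tv']] : exists v', [/\ v' != 0,
    Q (j + n * size (enum I))%N v', forall i, T i v = 0 -> T i v' = 0 &
    forall i, i \in enum I -> T i v' = 0].
  exists v'; split=> //; first by rewrite cardE.
  by move=> i; apply: Tv'; rewrite mem_enum.
elim: (enum I) j v vn0 nilv Qv => [|i s IHs] j v v0 nilv Qv.
  by exists v; split=> //; rewrite muln0 addn0.
have last_nonzero p : iter p (T i) v = 0 -> exists m,
    [/\ (m <= p)%N, iter m (T i) v != 0 & T i (iter m (T i) v) = 0].
  elim: p => [|p IHp] /=; first by move/eqP; rewrite (negPf v0).
  have [/IHp [m [mn ? ?]] _|ne0 e0] := eqVneq (iter p (T i) v) 0.
    by exists m; split=> //; apply: leqW.
  by exists p.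
have [m [mn mv0 Tmv]] := last_nonzero _ (nilv i).
have Qw : Q (j + n)%N (iter m (T i) v).
  rewrite -(subnKC mn) addnA; apply: Qm; elim: m {mn mv0 Tmv} => [|m IHm] /=.
    by rewrite addn0.
  by rewrite addnS; apply: QT.
have TTn k : iter n (T k) (iter m (T i) v) = 0.
  elim: m {mn mv0 Tmv Qw} => [|m IHm]; first exact: nilv.
  by rewrite iterS iterC IHm T0.
have [v' [v'0 Qv' Kv' Tv']] := IHs _ _ mv0 TTn Qw.
exists v'; split=> //; first by rewrite /= mulnS addnA.
- move=> k Tk; apply: Kv'; elim: m {mn mv0 Tmv Qw TTn} => [//|m IHm].
  by rewrite iterS Tcomm IHm T0.
- by move=> k; rewrite inE => /orP[/eqP ->|/Tv' //]; apply: Kv'.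
Qed.

Section IteratedCommutator.
Variables (A : pzRingType).

Definition ad (v d : A) : A := v * d - d * v.

Lemma ad0 v : ad v 0 = 0.
Proof. by rewrite /ad mulr0 mul0r subrr. Qed.

Lemma adD v d e : ad v (d + e) = ad v d + ad v e.
Proof. by rewrite /ad mulrDr mulrDl opprD addrACA. Qed.

Lemma adM v d e : ad v (d * e) = ad v d * e + d * ad v e.
Proof. by rewrite /ad mulrBl mulrBr !mulrA addrA subrK. Qed.

Lemma ad_eq0 v d : GRing.comm v d -> ad v d = 0.
Proof. by rewrite /ad => ->; rewrite subrr. Qed.

Lemma iter_ad0 v n : iter n (ad v) 0 = 0.
Proof. by elim: n => //= n ->; exact: ad0. Qed.

Lemma iter_ad_sum v n (I : Type) (r : seq I) (F : I -> A) :
  iter n (ad v) (\sum_(i <- r) F i) = \sum_(i <- r) iter n (ad v) (F i).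
Proof.
elim: r => [|i r IHr]; first by rewrite !big_nil iter_ad0.
rewrite !big_cons -IHr; elim: n {IHr} => //= n ->; exact: adD.
Qed.

(* [ad v] acts on words in [x] and [e] as the derivation [e * d/dx]. *)
Lemma iter_ad_exp v x n i : GRing.comm v (ad v x) -> GRing.comm x (ad v x) ->
  iter n (ad v) (x ^+ i) = (ad v x) ^+ n * x ^+ (i - n) *+ (i ^_ n).
Proof.
set e := ad v x => ve xe.
have adX k : ad v (x ^+ k) = e * x ^+ k.-1 *+ k.
  elim: k => [|k IHk]; first by rewrite expr0 mulr0n ad_eq0 //; apply: commr1.
  rewrite exprS adM IHk -/e mulrS; congr (_ + _); rewrite mulrnAr.
  by case: k {IHk} => [|k]; rewrite ?mulr0n // mulrA xe -mulrA -exprS.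
have adMn k d : ad v (d *+ k) = ad v d *+ k.
  by elim: k => [|k IHk]; rewrite ?mulr0n ?ad0 // !mulrSr adD IHk.
elim: n => [|n IHn] /=; first by rewrite expr0 mul1r subn0 ffactn0 mulr1n.
rewrite IHn adMn adM (ad_eq0 (commrX _ ve)) mul0r add0r adX.
rewrite mulrnAr mulrA -exprSr -mulrnA subnS ffactnSr.
by rewrite mulnC.
Qed.

Lemma iter_ad_expn v x n : GRing.comm v (ad v x) -> GRing.comm x (ad v x) ->
  iter n (ad v) (x ^+ n) = (ad v x) ^+ n *+ n`!.
Proof. by move=> ve xe; rewrite iter_ad_exp // subnn mulr1 ffactnn. Qed.

Lemma iter_ad_expn_lt v x n i : GRing.comm v (ad v x) ->
  GRing.comm x (ad v x) -> (i < n)%N -> iter n (ad v) (x ^+ i) = 0.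
Proof. by move=> ve xe lt_in; rewrite iter_ad_exp // ffact_small ?mulr0n. Qed.

End IteratedCommutator.

(** * Operators on the Segre ring *)

Section SegreOperators.
Variables (K : fieldType) (a b : nat).
Local Notation S := {mpoly K[a.+1 + b.+1]}.
Local Notation R := (segre_ring K a b).
Local Notation in_segre p := (p \in gen_subalg (@segre_mons K a b)).
Local Notation ix := (@lshift a.+1 b.+1).
Local Notation iy := (@rshift a.+1 b.+1).

Lemma segre_ind (P : S -> Prop) :
  P 1 -> (forall c p q, P p -> P q -> P (c *: p + q)) ->
  (forall i j p, in_segre p -> P p -> P (segre_mon K i j * p)) ->
  forall p, in_segre p -> P p.
Proof.
move=> P1 PD PM p; rewrite inE => pS.
(* [P] need not be stable under products, but the multipliers that preserve [P] form a subalgebra;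
   the claim follows by applying such a multiplier to 1. *)
pose B : {pred S} := [pred p | in_segre p &&
  `[< forall q, in_segre q -> P q -> P (p * q) >]].
have [c1 cZ cM] := gen_subalg_closed (@segre_mons K a b).
have /pS : subalg_closed B.
  split.
  - rewrite !inE; apply/andP; split; first by move: c1; rewrite inE.
    by apply/asboolP => q _; rewrite mul1r.
  - move=> c f g /andP[fS /asboolP Pf] /andP[gS /asboolP Pg].
    apply/andP; split; first exact: cZ.
    apply/asboolP => q qS Pq; rewrite mulrDl -scalerAl; apply: PD.
      exact: Pf.
    exact: Pg.
  - move=> f g /andP[fS /asboolP Pf] /andP[gS /asboolP Pg].
    apply/andP; split; first exact: cM.
    apply/asboolP => q qS Pq; rewrite -mulrA; apply: Pf; last exact: Pg.
    exact: cM.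
case/(_ _)/andP => [s [i [j ->]]|_ /asboolP Pp].
  by apply/andP; split; [apply: segre_gen_subproof | apply/asboolP/PM].
by rewrite -[p]mulr1; apply: Pp => //; rewrite ?inE.
Qed.

Lemma in_segre1 : in_segre (1 : S).
Proof. by have [] := gen_subalg_closed (@segre_mons K a b). Qed.

Lemma in_segreD p q : in_segre p -> in_segre q -> in_segre (p + q).
Proof.
have [_ + _] := gen_subalg_closed (@segre_mons K a b).
by move=> H pS qS; have := H 1 p q pS qS; rewrite scale1r.
Qed.

Lemma in_segre0 : in_segre (0 : S).
Proof.
have [S1 + _] := gen_subalg_closed (@segre_mons K a b).
by move/(_ (-1) 1 1 S1 S1); rewrite scaleN1r addNr.
Qed.

Lemma in_segreZ c p : in_segre p -> in_segre (c *: p).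
Proof.
have [_ + _] := gen_subalg_closed (@segre_mons K a b).
by move=> H pS; have := H c p 0 pS in_segre0; rewrite addr0.
Qed.

Lemma in_segreM p q : in_segre p -> in_segre q -> in_segre (p * q).
Proof. by have [_ _] := gen_subalg_closed (@segre_mons K a b); apply. Qed.

Definition restrict_fun (f : S -> S)
    (fS : forall p, in_segre p -> in_segre (f p)) (r : R) : R :=
  SegreRing (fS _ (segre_valP r)).

(** The commutator of the restriction with [r] is the restriction of the commutator. In order 0 the
    multiplier is the value at 1, which therefore lies in the subring. *)
Lemma restrict_le n f (fS : forall p, in_segre p -> in_segre (f p)) :
  diffop_le n f -> diffop_le n (restrict_fun fS).
Proof.
elim: n f fS => [|n IHn] f fS.
  move=> [r fE]; exists (SegreRing (fS _ in_segre1)) => x; apply: val_inj.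
  by rewrite /= !fE mulr1.
move=> [lf fn]; split; first by move=> c x y; apply: val_inj; exact: lf.
move=> r.
have gS p : in_segre p -> in_segre (f (val r * p) - val r * f p).
  move=> pS; apply: in_segreD.
    by apply/fS/in_segreM => //; apply: segre_valP.
  rewrite -scaleN1r; apply/in_segreZ/in_segreM; last exact: fS.
  exact: segre_valP.
apply: eq_diffop_le (IHn _ gS (fn (val r))) => x.
by apply: val_inj.
Qed.

Lemma restrict_subproof n f (fS : forall p, in_segre p -> in_segre (f p)) :
  diffop_le n f -> `[< exists n, diffop_le n (restrict_fun fS) >].
Proof. by move=> fn; apply/asboolP; exists n; apply: restrict_le. Qed.

Definition restrict n f (fS : forall p, in_segre p -> in_segre (f p))
  (fn : diffop_le n f) : diffop R := Diffop (restrict_subproof fS fn).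

Lemma segre_val_sum (X : Type) (s : seq X) (r : X -> R) :
  segre_val (\sum_(x <- s) r x) = \sum_(x <- s) segre_val (r x).
Proof.
by apply: (big_rec2 (fun (e : R) p => segre_val e = p)) => //= i x y _ <-.
Qed.

Lemma mderiv_var (i j : 'I_(a.+1 + b.+1)) :
  ('X_j : S)^`M(i) = (i == j)%:R.
Proof.
rewrite mderivX mnm1E eq_sym; case: eqP => [->|_]; last by rewrite scale0r.
by rewrite scale1r -{1}[U_(j)%MM]add0m addmK mpolyX0.
Qed.

Lemma mulop_le (p : S) : diffop_le 0 (fun q => p * q).
Proof. by exists p. Qed.

Lemma mderiv_le i : diffop_le 1 (fun p : S => p^`M(i)).
Proof.
split; first by move=> c p q; rewrite mderivD mderivZ.
by move=> r; exists r^`M(i) => p; rewrite mderivM addrK.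
Qed.

Definition mvf (i j : 'I_(a.+1 + b.+1)) (p : S) : S := 'X_i * p^`M(j).

Lemma mvf_le i j : diffop_le 1 (mvf i j).
Proof. exact: (diffop_le_comp (mulop_le _) (mderiv_le _)). Qed.

Lemma mvfM i j p q : mvf i j (p * q) = mvf i j p * q + p * mvf i j q.
Proof. by rewrite /mvf mderivM; ring. Qed.

Lemma mvfZD i j c p q : mvf i j (c *: p + q) = c *: mvf i j p + mvf i j q.
Proof. by rewrite /mvf mderivD mderivZ mulrDr scalerAr. Qed.

(** By the Leibniz rule a derivation preserves the subalgebra once it maps the generators into
    it. *)
Lemma mvf_segre i j : (forall k l, in_segre (mvf i j (segre_mon K k l))) ->
  forall p, in_segre p -> in_segre (mvf i j p).
Proof.
move=> gS; apply: segre_ind.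
- by rewrite /mvf mderivC mulr0 in_segre0.
- by move=> c p q pS qS; rewrite mvfZD; apply/in_segreD => //; apply: in_segreZ.
- move=> k l p pS fpS; rewrite mvfM; apply: in_segreD; apply: in_segreM => //.
  exact: segre_gen_subproof.
Qed.

Lemma in_segre_bool (c : bool) p : in_segre p -> in_segre (c%:R * p).
Proof. by case: c; rewrite ?mul1r ?mul0r // => _; apply: in_segre0. Qed.

Lemma mvf_xmon k m i j :
  mvf (ix k) (ix m) (segre_mon K i j) = (m == i)%:R * segre_mon K k j.
Proof.
rewrite /mvf /segre_mon mderivM !mderiv_var eq_lrshift eq_lshift mulr0 addr0.
by rewrite mulrCA.
Qed.

Lemma mvf_ymon k m i j :
  mvf (iy k) (iy m) (segre_mon K i j) = (m == j)%:R * segre_mon K i k.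
Proof.
rewrite /mvf /segre_mon mderivM !mderiv_var eq_rlshift eq_rshift mul0r add0r.
by rewrite mulrC mulrCA mulrA.
Qed.

Lemma mvfx_segre k m p : in_segre p -> in_segre (mvf (ix k) (ix m) p).
Proof.
apply: mvf_segre => i j; rewrite mvf_xmon.
apply/in_segre_bool/segre_gen_subproof.
Qed.

Lemma mvfy_segre k m p : in_segre p -> in_segre (mvf (iy k) (iy m) p).
Proof.
apply: mvf_segre => i j; rewrite mvf_ymon.
apply/in_segre_bool/segre_gen_subproof.
Qed.

Definition dxy k l (p : S) : S := p^`M(ix k)^`M(iy l).

Lemma dxy_le k l : diffop_le 2 (dxy k l).
Proof. exact: (diffop_le_comp (mderiv_le (iy l)) (mderiv_le (ix k))). Qed.

(** The commutator of V_kl with X_ij involves only constants and the operators E and E', all of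
    which preserve R. This gives the induction step showing that V_kl preserves R, although a single
    partial derivative does not. *)
Lemma dxy_mon k l i j p : dxy k l (segre_mon K i j * p) =
  (k == i)%:R * ((l == j)%:R * p) + (k == i)%:R * mvf (iy j) (iy l) p +
  (l == j)%:R * mvf (ix i) (ix k) p + segre_mon K i j * dxy k l p.
Proof.
rewrite /dxy /mvf /segre_mon !(mderivM, mderivD, mderiv_var).
rewrite eq_lrshift eq_lshift eq_rlshift eq_rshift !mulr0n.
have d0 (c : bool) i' : (c%:R : S)^`M(i') = 0.
  by case: c; rewrite ?mderiv0 // mderivC.
rewrite !(d0, mderiv0); ring.
Qed.

Lemma dxyZD k l c p q : dxy k l (c *: p + q) = c *: dxy k l p + dxy k l q.
Proof. by rewrite /dxy !(mderivD, mderivZ). Qed.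

Lemma dxy_segre k l p : in_segre p -> in_segre (dxy k l p).
Proof.
move: p; apply: segre_ind.
- by rewrite /dxy mderivC mderiv0 in_segre0.
- by move=> c p q pS qS; rewrite dxyZD; apply/in_segreD => //; apply: in_segreZ.
- move=> i j p pS vpS; rewrite dxy_mon; apply: in_segreD; last first.
    by apply: in_segreM => //; apply: segre_gen_subproof.
  by do 2?[apply: in_segreD]; do !apply: in_segre_bool => //;
    [apply: mvfy_segre|apply: mvfx_segre].
Qed.

Definition opM (r : R) : diffop R :=
  restrict (fun p => in_segreM (segre_valP r)) (mulop_le _).
Definition opX k l : diffop R := opM (segre_gen K k l).
Definition opEx k m : diffop R := restrict (@mvfx_segre k m) (mvf_le _ _).
Definition opEy l m : diffop R := restrict (@mvfy_segre l m) (mvf_le _ _).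
Definition opV k l : diffop R := restrict (@dxy_segre k l) (dxy_le _ _).

Lemma opEq (d e : diffop R) :
  (forall r : R, segre_val (d r) = segre_val (e r)) -> d = e.
Proof. by move=> de; apply: diffop_eqP => r; apply: val_inj; apply: de. Qed.

Lemma op_boolE (c : bool) (r : R) :
  segre_val ((c%:R : diffop R) r) = c%:R * segre_val r.
Proof. by case: c; rewrite ?mul1r ?mul0r. Qed.

Lemma mderiv_bool (c : bool) i : (c%:R : S)^`M(i) = 0.
Proof. by case: c; rewrite ?mderiv0 // mderivC. Qed.

Definition weylE := (mderivM, mderivD, mderivB, mderiv_var, mderiv_bool,
  eq_lshift, eq_rshift, eq_lrshift, eq_rlshift, mulr0n, mderiv0).

Lemma opM_comm r s : GRing.comm (opM r) (opM s).
Proof. by apply: opEq => p /=; rewrite mulrCA. Qed.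

Lemma opV_comm k l i j : GRing.comm (opV k l) (opV i j).
Proof.
apply: opEq => p; rewrite /= /dxy.
rewrite (mderiv_comm (iy j) (ix k)) (mderiv_comm (ix i) (ix k)).
by rewrite (mderiv_comm (iy j) (iy l)) (mderiv_comm (iy l) (ix i)).
Qed.

Lemma opE_comm k m i j : GRing.comm (opEx k m) (opEy i j).
Proof.
apply: opEq => p; rewrite /= /mvf !weylE (mderiv_comm (ix m) (iy j)); ring.
Qed.

Lemma opV_opX k l i j : opV k l * opX i j =
  (k == i)%:R * (l == j)%:R + (k == i)%:R * opEy j l +
  (l == j)%:R * opEx i k + opX i j * opV k l.
Proof. by apply: opEq => r; rewrite /= dxy_mon !op_boolE. Qed.

Lemma opX_opV k l : opX k l * opV k l = opEx k k * opEy l l.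
Proof.
by apply: opEq => r; rewrite /= /dxy /mvf /segre_mon !weylE mderiv_comm; ring.
Qed.

Lemma opV_opX_diag k l : opV k l * opX k l = (opEx k k + 1) * (opEy l l + 1).
Proof.
rewrite opV_opX !eqxx opX_opV mulrDl !mulrDr !mul1r mulr1.
rewrite addrC -!addrA; congr (_ + _); rewrite [RHS]addrA [RHS]addrC.
by congr (_ + _); apply: addrC.
Qed.

Lemma opEx_opV k m i j : opEx k m * opV i j =
  opV i j * opEx k m - (k == i)%:R * opV m j.
Proof.
apply: opEq => r; rewrite /= op_boolE /= /mvf /dxy !weylE (eq_sym k).
rewrite (mderiv_comm (iy j) (ix m)) (mderiv_comm (ix m) (ix i)).
by rewrite !mul0r !add0r addrAC subrr add0r.
Qed.

Lemma opEy_opV k m i j : opEy k m * opV i j =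
  opV i j * opEy k m - (k == j)%:R * opV i m.
Proof.
apply: opEq => r; rewrite /= op_boolE /= /mvf /dxy !weylE (eq_sym k).
rewrite (mderiv_comm (iy m) (ix i)) (mderiv_comm (iy m) (iy j) _^`M(ix i)).
by rewrite !mul0r !add0r addrAC subrr add0r.
Qed.

Lemma ad_opEx_opM k m (r : R) : ad (opEx k m) (opM r) = opM (opEx k m r).
Proof. by apply: opEq => s /=; rewrite mvfM addrK. Qed.

Lemma ad_opEy_opM k m (r : R) : ad (opEy k m) (opM r) = opM (opEy k m r).
Proof. by apply: opEq => s /=; rewrite mvfM addrK. Qed.

Lemma opEx_gen k m i j :
  opEx k m (segre_gen K i j) = (m == i)%:R * segre_gen K k j.
Proof.
apply: val_inj; rewrite /= mvf_xmon.
by case: eqP => _; rewrite ?mul1r ?mul0r.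
Qed.

Lemma opEy_gen k m i j :
  opEy k m (segre_gen K i j) = (m == j)%:R * segre_gen K i k.
Proof.
apply: val_inj; rewrite /= mvf_ymon.
by case: eqP => _; rewrite ?mul1r ?mul0r.
Qed.

Lemma opEx_opEx k m i j : opEx k m * opEx i j = opEx i j * opEx k m +
  (m == i)%:R * opEx k j - (j == k)%:R * opEx i m.
Proof.
apply: opEq => r; rewrite /= !op_boolE /= /mvf !weylE.
by rewrite (mderiv_comm (ix m)); ring.
Qed.

Lemma opEy_opEy k m i j : opEy k m * opEy i j = opEy i j * opEy k m +
  (m == i)%:R * opEy k j - (j == k)%:R * opEy i m.
Proof.
apply: opEq => r; rewrite /= !op_boolE /= /mvf !weylE.
by rewrite (mderiv_comm (iy m)); ring.
Qed.

Lemma sum_opE : \sum_k opEx k k = \sum_l opEy l l.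
Proof.
apply: opEq => r.
rewrite !diffop_sumE !segre_val_sum /=.
elim/segre_ind: (segre_valP r) => [|c p q IHp IHq|i j p _ IHp].
- by rewrite !big1 // => i _; rewrite /mvf mderivC mulr0.
- by under eq_bigr do rewrite mvfZD; under [RHS]eq_bigr do rewrite mvfZD;
    rewrite !big_split /= -!scaler_sumr IHp IHq.
- under eq_bigr do rewrite mvfM mvf_xmon.
  under [RHS]eq_bigr do rewrite mvfM mvf_ymon.
  rewrite !big_split /= -!mulr_sumr IHp; congr (_ + _).
  rewrite (bigD1 i) //= [RHS](bigD1 j) //= !eqxx !mul1r.
  by rewrite !big1 // => k /negPf ->; rewrite !mul0r.
Qed.

End SegreOperators.

(** * Annihilators in a filtered module *)

Section ModuleFiltration.
Variables (K : fieldType) (a b : nat).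
Local Notation R := (segre_ring K a b).
Local Notation D := (diffop R).
Hypothesis charK0 : [pchar K] =i pred0.
Variables (M : lmodType D) (F : nat -> set M).
Hypotheses (F_le : forall n m, F n m -> F n.+1 m)
  (FD : forall n m m', F n m -> F n m' -> F n (m + m')).

Definition raises (d : D) := forall n m, F n m -> F n.+1 (d *: m).

Hypotheses (FX : forall k l, raises (opX K k l))
  (FEx : forall k m, raises (opEx K b k m))
  (FEy : forall l m, raises (opEy K a l m))
  (FV : forall k l, raises (opV K k l)).

Variable J : nat.

Definition kills j (d : D) := forall i m, (i + j <= J)%N -> F i m -> d *: m = 0.

Lemma killsS j d : kills j d -> kills j.+1 d.
Proof.
by move=> kd i m ij; apply: kd; apply: leq_trans ij; rewrite leq_add2l.
Qed.

Lemma kills_ad j g d : raises g -> kills j d -> kills j.+1 (ad g d).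
Proof.
move=> gF kd i m ij Fm; rewrite /ad scalerBl -!scalerA.
rewrite (kd i m) // ?scaler0 ?sub0r; last by rewrite ltnW // -addnS.
by rewrite (kd i.+1) ?oppr0 //; [rewrite addSnnS | apply: gF].
Qed.

Lemma kills_iter_ad j n g d : raises g -> kills j d ->
  kills (j + n) (iter n (ad g) d).
Proof.
move=> gF kd; elim: n => [|n IHn]; first by rewrite addn0.
by rewrite addnS; apply: kills_ad.
Qed.

Lemma kills_mull j c d : kills j d -> kills j (c * d).
Proof. by move=> kd i m ij Fm; rewrite -scalerA (kd i m) // scaler0. Qed.

Lemma natr_neq0 n : (n.+1)%:R != 0 :> K.
Proof. by move/pcharf0P: charK0 => ->. Qed.

Lemma kills_natr j n d : (0 < n)%N -> kills j (d *+ n) -> kills j d.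
Proof.
case: n => // n _ kd; have -> : d = (n.+1%:R^-1 : K)%:A * (d *+ n.+1).
  rewrite mulr_algl -scaler_nat scalerA mulVf ?natr_neq0 //.
  by rewrite scale1r.
exact: kills_mull.
Qed.

(** The device that passes nilpotency from [x] to [e], the factor n! being invertible. Brackets of
    the generators come with either sign, and (-1)^n is removed by a left multiplication. *)
Lemma kills_adX j n v x e : raises v -> ad v x = e \/ ad v x = - e ->
  GRing.comm v e -> GRing.comm x e -> kills j (x ^+ n) ->
  kills (j + n) (e ^+ n).
Proof.
move=> vF adE ve xe kx.
have := kills_iter_ad (n := n) vF kx.
rewrite iter_ad_expn; try by case: adE => -> //; apply: commrN.
move/kills_natr => /(_ (fact_gt0 _)).
case: adE => -> // /((kills_mull ((-1) ^+ n))).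
by rewrite (exprNn e) mulrA -expr2 sqrr_sign mul1r.
Qed.

Lemma neq_exists n (i : 'I_n.+2) : exists j : 'I_n.+2, j != i.
Proof.
have [->|i0] := eqVneq i ord0; first by exists ord_max.
by exists ord0; rewrite eq_sym.
Qed.

Lemma comm_opEx_opX (p k : 'I_a.+1) (l : 'I_b.+1) :
  p != k -> GRing.comm (opX K p l) (opEx K b p k).
Proof.
move=> pk; apply/commr_sym/subr0_eq; rewrite -/(ad _ _) ad_opEx_opM opEx_gen.
rewrite eq_sym (negPf pk) mul0r; apply: opEq => r /=; exact: mul0r.
Qed.

Lemma comm_opEx_opV (p k : 'I_a.+1) (l : 'I_b.+1) :
  p != k -> GRing.comm (opV K k l) (opEx K b p k).
Proof.
move=> pk; apply/commr_sym.
by rewrite /GRing.comm opEx_opV (negPf pk) mul0r subr0.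
Qed.

Lemma comm_opEy_opX (k : 'I_a.+1) (p l : 'I_b.+1) :
  p != l -> GRing.comm (opX K k p) (opEy K a p l).
Proof.
move=> pk; apply/commr_sym/subr0_eq; rewrite -/(ad _ _) ad_opEy_opM opEy_gen.
rewrite eq_sym (negPf pk) mul0r; apply: opEq => r /=; exact: mul0r.
Qed.

Lemma comm_opEy_opV (k : 'I_a.+1) (p l : 'I_b.+1) :
  p != l -> GRing.comm (opV K k l) (opEy K a p l).
Proof.
move=> pk; apply/commr_sym.
by rewrite /GRing.comm opEy_opV (negPf pk) mul0r subr0.
Qed.

Lemma ad_opV_opEy (k : 'I_a.+1) (l0 l1 : 'I_b.+1) :
  ad (opV K k l0) (opEy K a l0 l1) = opV K k l1.
Proof. by rewrite /ad opEy_opV eqxx mul1r opprB addrC subrK. Qed.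

Lemma ad_opV_opEx (k p : 'I_a.+1) (l : 'I_b.+1) :
  ad (opV K p l) (opEx K b p k) = opV K k l.
Proof. by rewrite /ad opEx_opV eqxx mul1r opprB addrC subrK. Qed.

Lemma ad_opX_opV (k p : 'I_a.+1) (l : 'I_b.+1) : p != k ->
  ad (opX K p l) (opV K k l) = - opEx K b p k.
Proof.
rewrite eq_sym => pk; rewrite /ad opV_opX (negPf pk) eqxx !mul0r !add0r mul1r.
by rewrite opprD addrCA subrr addr0.
Qed.

Lemma ad_opX_opEx (k p : 'I_a.+1) (l : 'I_b.+1) :
  ad (opX K k l) (opEx K b p k) = - opX K p l.
Proof.
by rewrite /ad -opprB -/(ad _ _) ad_opEx_opM opEx_gen eqxx mul1r.
Qed.

Lemma ad_opV_opX (k : 'I_a.+1) (l0 l1 : 'I_b.+1) : l0 != l1 ->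
  ad (opV K k l1) (opX K k l0) = opEy K a l0 l1.
Proof.
rewrite eq_sym => pk; rewrite /ad opV_opX (negPf pk) eqxx !mul0r mulr0 addr0.
by rewrite add0r mul1r addrK.
Qed.

(** Three brackets, each costing [n] steps: V_(k,l0) takes E'_(l0,l1) to V_(k,l1); X_(p,l1) takes
    that to E_pk up to sign, for p different from k; finally X and V take the E to all X_kl and
    V_kl. An index p other than k exists because [a] is positive. *)
Lemma nilpotent_spread (a_ge1 : (0 < a)%N) j n l0 l1 : l0 != l1 ->
  kills j (opEy K a l0 l1 ^+ n) -> forall k l,
  kills (j + 3 * n) (opX K k l ^+ n) /\ kills (j + 3 * n) (opV K k l ^+ n).
Proof.
move=> ll kE.
have kV1 k : kills (j + n) (opV K k l1 ^+ n).
  apply: kills_adX (FV k l0) _ _ _ kE; first by left; apply: ad_opV_opEy.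
    exact: opV_comm.
  exact/commr_sym/comm_opEy_opV.
have kE1 p k : p != k -> kills (j + n + n) (opEx K b p k ^+ n).
  move=> pk; apply: kills_adX (FX p l1) _ _ _ (kV1 k).
  - by right; apply: ad_opX_opV.
  - exact: comm_opEx_opX.
  - exact: comm_opEx_opV.
have -> : (j + 3 * n = j + n + n + n)%N by lia.
have neq k : exists p : 'I_a.+1, p != k.
  by case: (a) a_ge1 k => // a' _ k; apply: neq_exists.
move=> k l; split.
  have [p pk] := neq k; rewrite eq_sym in pk.
  apply: kills_adX (FX p l) _ _ _ (kE1 k p pk).
  - by right; apply: ad_opX_opEx.
  - exact: opM_comm.
  - exact/commr_sym/comm_opEx_opX.
have [p pk] := neq k.
apply: kills_adX (FV p l) _ _ _ (kE1 p k pk).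
- by left; apply: ad_opV_opEx.
- exact: opV_comm.
- exact/commr_sym/comm_opEx_opV.
Qed.

(** Either all [s i] kill [m], or some nonzero [s i *: m] is killed by all [t l]. The form of [m']
    is recorded so that eigenvalues of operators commuting with [s i] survive. *)
Lemma split_kernel (I L : finType) (s : I -> D) (t : L -> D) n m :
  (forall i, raises (s i)) -> (forall i l, GRing.comm (s i) (t l)) ->
  (forall i l, (s i * t l) *: m = 0) -> m != 0 -> F n m ->
  exists m', [/\ m' != 0, F n.+1 m', m' = m \/ (exists i, m' = s i *: m) &
    (forall i, s i *: m' = 0) \/ (forall l, t l *: m' = 0)].
Proof.
move=> sF st stm m0 Fm.
have [/existsP [i sm0]|/existsPn sm] := boolP [exists i, s i *: m != 0].
  exists (s i *: m); split=> //; [exact: sF|by right; exists i|right=> l].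
  by rewrite scalerA -st stm.
exists m; split=> //; [exact: F_le|by left|left=> i].
by apply/eqP; move: (sm i); rewrite negbK.
Qed.

Local Notation theta := (\sum_k opEx K b k k).

Lemma theta_opV (i : 'I_a.+1) (j : 'I_b.+1) :
  theta * opV K i j = opV K i j * theta - opV K i j.
Proof.
rewrite mulr_suml mulr_sumr.
under eq_bigr do rewrite opEx_opV.
rewrite sumrB.
congr (_ - _); rewrite (bigD1 i) //= eqxx mul1r big1 ?addr0 //.
by move=> k /negPf ->; rewrite mul0r.
Qed.

Lemma comm_theta_opEx (k : 'I_a.+1) : GRing.comm theta (opEx K b k k).
Proof.
apply/commr_sym/commr_sum => i _; rewrite /GRing.comm opEx_opEx (eq_sym i).
by case: eqP => [->|_]; rewrite ?mul0r ?addr0 ?subr0 // addrK.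
Qed.

Lemma iter_scaler n (d : D) (m : M) : iter n (fun x => d *: x) m = d ^+ n *: m.
Proof.
by elim: n => [|n IHn]; rewrite ?expr0 ?scale1r // iterS IHn scalerA -exprS.
Qed.

Lemma nilpotent_false j j0 n (m : M) : m != 0 -> F j0 m ->
  (forall k l, kills j (opX K k l ^+ n) /\ kills j (opV K k l ^+ n)) ->
  (j0 + n * (a.+1 * b.+1) + 1 + j <= J)%N -> False.
Proof.
move=> m0 Fm kXV leJ.
have card2 : #|{: 'I_a.+1 * 'I_b.+1}| = (a.+1 * b.+1)%N.
  by rewrite card_prod !card_ord.
have [|||||||m1 [m10 Fm1 Xm1]] := @common_kernel M
  ('I_a.+1 * 'I_b.+1)%type (fun p x => opX K p.1 p.2 *: x) F n j0 m.
- by move=> p; rewrite scaler0.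
- by move=> p q x; rewrite !scalerA opM_comm.
- by [].
- by move=> p; apply: FX.
- move=> p; rewrite iter_scaler; apply: (kXV p.1 p.2).1 Fm.
  by apply: leq_trans leJ; lia.
- by [].
- by [].
rewrite card2 in Fm1.
(* All X_kl kill [m1], hence so do the products V_kl X_kl = (E_kk + 1)(E'_ll + 1). *)
pose s1 k : D := opEx K b k k + 1; pose t1 l : D := opEy K a l l + 1.
have [|k l|k l|m2 [m20 Fm2 _ st]] := @split_kernel _ _ s1 t1 _ m1 _ _ _ m10 Fm1.
- move=> k i x Fx; rewrite scalerDl scale1r; apply: FD; first exact: FEx.
  exact: F_le.
- apply/commrD/commr1; apply/commr_sym/commrD/commr1/commr_sym; exact: opE_comm.
- by rewrite -opV_opX_diag -scalerA (Xm1 (k, l)) scaler0.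
(* Either every E_kk or every E'_ll acts on [m2] as -1, and theta is the sum of the a+1 former or of
   the b+1 latter. *)
have [c cP thetam2] : exists2 c : nat, (0 < c)%N & theta *: m2 = - (m2 *+ c).
  have sumN (I : finType) (d : I -> D) : (forall i, (d i + 1) *: m2 = 0) ->
      (\sum_i d i) *: m2 = - (m2 *+ #|I|).
    move=> dm2; rewrite scaler_suml -sumr_const -sumrN.
    apply: eq_bigr => i _; apply/eqP; rewrite -addr_eq0.
    by move: (dm2 i); rewrite scalerDl scale1r => ->.
  case: st => [sm2|tm2]; [exists a.+1|exists b.+1] => //.
    by rewrite (sumN _ _ sm2) card_ord.
  by rewrite sum_opE (sumN _ _ tm2) card_ord.
(* Having a negative integer as eigenvalue of theta is preserved by the V_kl, each of which lowers
   that eigenvalue by one. *)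
pose Q i x := F i x /\ exists2 c : nat, (0 < c)%N & theta *: x = - (x *+ c).
have [||||||m3 [m30 [Fm3 [e eP thetam3]] Vm3]] := @common_kernel M
  ('I_a.+1 * 'I_b.+1)%type (fun p x => opV K p.1 p.2 *: x) Q n
  (j0 + n * (a.+1 * b.+1)).+1 m2 _ _ _ _ _ m20.
- by move=> p; rewrite scaler0.
- by move=> p q x; rewrite !scalerA opV_comm.
- by move=> i x [Fx thx]; split=> //; apply: F_le.
- move=> p i x [Fx [d dP thx]]; split; first exact: FV.
  exists d.+1 => //; rewrite scalerA theta_opV scalerBl -scalerA thx.
  by rewrite scalerN -scalerMnr mulrSr opprD.
- move=> p; rewrite iter_scaler; apply: (kXV p.1 p.2).2 Fm2.
  by apply: leq_trans leJ; lia.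
- by split; [exact: Fm2 | exists c].
have [||k l|m4 [m40 _ m4E st4]] := @split_kernel _ _ (fun k => opEx K b k k)
  (fun l => opEy K a l l) _ m3 _ _ _ m30 Fm3.
- by move=> k; apply: FEx.
- by move=> k l; apply: opE_comm.
- by rewrite -opX_opV -scalerA (Vm3 (k, l)) scaler0.
have theta0 : theta *: m4 = 0.
  case: st4 => [sm4|tm4]; last rewrite sum_opE.
    by rewrite scaler_suml big1 // => k _; exact: sm4.
  by rewrite scaler_suml big1 // => l _; exact: tm4.
(* [m4] is [m3] or some E_kk applied to it, and theta commutes with E_kk. *)
have thetaN : theta *: m4 = - (m4 *+ e).
  case: m4E => [->//|[k ->]].
  by rewrite scalerA comm_theta_opEx -scalerA thetam3 scalerN -scalerMnr.
move/eqP: thetaN; rewrite theta0 eq_sym oppr_eq0; apply/negP.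
case: e eP {thetam3} => // e _; apply: contra_neq m40 => m4e.
have := congr1 (fun x => (e.+1%:R^-1 : K)%:A *: x) m4e.
rewrite scaler0 -scaler_nat scalerA mulr_algl -(scaler_nat _ (1 : D)) scalerA.
by rewrite mulVf ?natr_neq0 // !scale1r.
Qed.

End ModuleFiltration.

(** * Degrees of products and derivatives of polynomials *)

Section Degrees.
Variables (K : fieldType) (n : nat).
Implicit Types (p q : {mpoly K[n]}).

Lemma msizeM_leq p q : (msize (p * q) <= (msize p + msize q).-1)%N.
Proof.
have [->|p0] := eqVneq p 0; first by rewrite mul0r mmeasure0.
have [->|q0] := eqVneq q 0; first by rewrite mulr0 mmeasure0.
by rewrite msizeM.
Qed.

Lemma msize_mderiv i p : (msize p^`M(i) <= (msize p).-1)%N.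
Proof.
rewrite [X in (X <= _)%N]msizeE; apply/bigmax_leqP_seq => m.
rewrite mcoeff_msupp mcoeff_deriv => pm _.
have : (m + U_(i))%MM \in msupp p.
  by rewrite mcoeff_msupp; apply: contraNneq pm => ->; rewrite mul0rn.
by move/msize_mdeg_lt; rewrite mdegD mdeg1 addn1; case: (msize p).
Qed.

Lemma msize_iter_mderiv i k p :
  (msize (iter k (mderiv i) p) <= msize p - k)%N.
Proof.
elim: k => [|k IHk]; first by rewrite subn0.
by rewrite iterS subnS (leq_trans (msize_mderiv _ _)) // -!subn1 leq_sub2r.
Qed.

Lemma msizeMX_le i p : (msize ('X_i * p) <= (msize p).+1)%N.
Proof.
by apply: leq_trans (msizeM_leq _ _) _; rewrite msizeX mdeg1.
Qed.

Lemma msize_mulX_mderiv i j p : (msize ('X_i * p^`M(j)) <= msize p)%N.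
Proof.
have [->|p0] := eqVneq p 0; first by rewrite mderiv0 mulr0 mmeasure0.
apply: leq_trans (msizeMX_le _ _) _; apply: leq_ltn_trans (msize_mderiv _ _) _.
by rewrite prednK // lt0n msize_poly_eq0.
Qed.

(** The variable of index [i] is a constant for the derivative in a different variable. Hence enough
    iterations kill any given polynomial, which makes the E_0k and E'_0l locally nilpotent. *)
Lemma iter_mulX_mderiv i j k p : i != j ->
  iter k (fun q => 'X_i * q^`M(j)) p = 'X_i ^+ k * iter k (mderiv j) p.
Proof.
move=> ij; elim: k => [|k IHk]; first by rewrite mul1r.
rewrite !iterS IHk mderivM.
suff -> : ('X_i ^+ k : {mpoly K[n]})^`M(j) = 0.
  by rewrite mul0r add0r mulrA exprS.
by rewrite mpolyXn mderivX mulmnE mnm1E (negPf ij) mul0n scale0r.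
Qed.

End Degrees.

(** * Degree growth of operators, and reduction to order zero *)

Section OrderReduction.
Variables (K : fieldType) (a b : nat).
Local Notation R := (segre_ring K a b).
Local Notation D := (diffop R).

(** The degree is taken in the polynomial ring, where a generator of R has degree 2; the shift by
    one in [msize] cancels. *)
Definition grows e (d : D) :=
  forall r, (msize (segre_val (d r)) <= msize (segre_val r) + e)%N.

Lemma grows_leq e e' d : (e <= e')%N -> grows e d -> grows e' d.
Proof. by move=> ee gd r; apply: leq_trans (gd r) _; rewrite leq_add2l. Qed.

Lemma growsM e e' d d' : grows e d -> grows e' d' -> grows (e + e') (d * d').
Proof.
move=> gd gd' r; apply: leq_trans (gd _) _.
by rewrite (addnC e) addnA leq_add2r; apply: gd'.
Qed.

Lemma growsD e d d' : grows e d -> grows e d' -> grows e (d + d').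
Proof.
move=> gd gd' r.
have -> : segre_val ((d + d') r) = segre_val (d r) + segre_val (d' r) by [].
by apply: leq_trans (msizeD_le _ _) _; rewrite geq_max gd gd'.
Qed.

Lemma growsZ e c d : grows e d -> grows e (c *: d).
Proof.
move=> gd r; rewrite -[segre_val _]/(c *: segre_val (d r)).
exact: leq_trans (msizeZ_le _ _) _.
Qed.

Lemma grows0 e : grows e 0.
Proof.
by move=> r; rewrite -[segre_val _]/(0 : {mpoly K[a.+1 + b.+1]}) mmeasure0.
Qed.

Lemma growsN e d : grows e d -> grows e (- d).
Proof.
by move=> gd r; rewrite -[segre_val _]/(- segre_val (d r)) msizeN; apply: gd.
Qed.

Lemma grows1 : grows 0 1.
Proof. by move=> r; rewrite addn0. Qed.

Lemma grows_opX k l : grows 2 (opX K k l).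
Proof.
move=> r; rewrite addn2 /= /segre_mon -mulrA.
by apply: leq_trans (msizeMX_le _ _) _; rewrite ltnS; apply: msizeMX_le.
Qed.

Lemma grows_opEx k m : grows 0 (opEx K b k m).
Proof. by move=> r; rewrite addn0; apply: msize_mulX_mderiv. Qed.

Lemma grows_opEy k m : grows 0 (opEy K a k m).
Proof. by move=> r; rewrite addn0; apply: msize_mulX_mderiv. Qed.

Lemma grows_ad e e' g d : grows e g -> grows e' d -> grows (e' + e) (ad g d).
Proof.
move=> gg gd; apply: growsD; first by rewrite addnC; apply: growsM.
exact/growsN/growsM.
Qed.

Lemma diffop_leN n (f : R -> R) : diffop_le n f -> diffop_le n (fun x => - f x).
Proof.
move=> fn; have n0 : diffop_le n (fun _ : R => 0).
  by apply: diffop_le_leq (leq0n n) _; exists 0 => x; rewrite mul0r.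
by apply: eq_diffop_le (diffop_le_lin (-1) fn n0) => x; rewrite scaleN1r addr0.
Qed.

(** Up to sign, the bracket with a multiplication is the commutator in the definition of order: each
    one lowers the order, and multiplications commute. *)
Lemma iter_ad_opM n (d : D) r : diffop_le n d -> iter n.+1 (ad (opM r)) d = 0.
Proof.
rewrite iterSr; elim: n d => [|n IHn] d dn.
  case: dn => s dE; apply: opEq => x; rewrite /= !dE /=.
  by rewrite mulrCA subrr.
rewrite iterSr; apply: IHn; case: dn => _ /(_ r)/diffop_leN.
apply: eq_diffop_le => x; apply: val_inj => /=; rewrite opprB; congr (_ - _).
congr (segre_val (d _)); exact: val_inj.
Qed.

Lemma ad_comm (g h d : D) : GRing.comm g h -> ad g (ad h d) = ad h (ad g d).
Proof.
move=> gh; rewrite /ad !mulrBr !mulrBl !opprB !mulrA gh -(mulrA d h g) -gh.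
by rewrite mulrA addrACA [RHS]addrACA; congr (_ + _); apply: addrC.
Qed.

(** An operator commuting with the generators of R is R-linear, hence determined by its value at
    1. *)
Lemma opM_eq (d : D) : (forall k l, ad (opX K k l) d = 0) -> d = opM (d 1).
Proof.
move=> dX; apply: opEq => r; rewrite /= mulrC.
suff dE p (pS : p \in gen_subalg (@segre_mons K a b)) :
    segre_val (d (SegreRing pS)) = p * segre_val (d 1).
  by case: r => p pS; rewrite dE mulrC.
(* [segre_ind] needs a predicate on polynomials alone, so the membership proof is quantified
   existentially; the value of [d] does not depend on it. *)
have : exists pS : p \in gen_subalg (@segre_mons K a b),
    segre_val (d (SegreRing pS)) = p * segre_val (d 1); last first.
  by case=> pS' <-; congr (segre_val (d _)); apply: val_inj.
move: {r} p pS; apply: segre_ind => [|c p q [pS Hp] [qS Hq]|i j p _ [pS Hp]].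
- exists (segre_valP (1 : R)); rewrite mul1r.
  by congr (segre_val (d _)); apply: val_inj.
- exists (segre_valP (c *: SegreRing pS + SegreRing qS)).
  rewrite mulrDl -scalerAl -Hp -Hq -[RHS]/(segre_val (c *: _ + _)).
  rewrite -(diffop_linear d).
  by congr (segre_val (d _)); apply: val_inj.
- exists (segre_valP (segre_gen K i j * SegreRing pS)).
  transitivity (segre_mon K i j * (p * segre_val (d 1))); last exact: mulrA.
  rewrite -Hp.
  have := congr1 (fun g : D => segre_val (g (SegreRing pS))) (dX i j).
  move/eqP; rewrite /= subr_eq0 => /eqP ->.
  by congr (segre_val (d _)); apply: val_inj.
Qed.

End OrderReduction.

(** * Elements of R killed by the E_0k and E'_0l *)

Section Coefficients.
Variables (K : fieldType) (a b : nat).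
Hypothesis charK0 : [pchar K] =i pred0.
Local Notation R := (segre_ring K a b).
Local Notation S := {mpoly K[a.+1 + b.+1]}.
Local Notation D := (diffop R).
Local Notation ix := (@lshift a.+1 b.+1).
Local Notation iy := (@rshift a.+1 b.+1).

Lemma segre_monE i j : segre_mon K i j = 'X_[U_(ix i) + U_(iy j)] :> S.
Proof. by rewrite mpolyXD. Qed.

Lemma segre_balanced (p : S) : p \in gen_subalg (@segre_mons K a b) ->
  forall m, m \in msupp p -> (\sum_i m (ix i) = \sum_j m (iy j))%N.
Proof.
move: p; apply: segre_ind => [m|c p q Hp Hq m|i j p _ Hp m].
- rewrite msupp1 inE => /eqP ->.
  by rewrite !big1 // => i _; rewrite mnm0E.
- by move/msuppD_le; rewrite mem_cat => /orP[/msuppZ_le/Hp|/Hq].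
- rewrite segre_monE mulrC (perm_mem (msuppMX _ _)) => /mapP[m' /Hp m'E ->].
  under eq_bigr do rewrite !mnmDE !mnm1E eq_lshift eq_rlshift addn0.
  under [RHS]eq_bigr do rewrite !mnmDE !mnm1E eq_lrshift eq_rshift add0n.
  rewrite !big_split /= m'E; congr (_ + _)%N.
  rewrite (bigD1 i) //= [RHS](bigD1 j) //= !eqxx.
  by rewrite !big1 // => k /negPf; rewrite eq_sym => ->.
Qed.

Lemma mderiv0_exp (p : S) i m : p^`M(i) = 0 -> m \in msupp p -> m i = 0%N.
Proof.
move=> dp; rewrite mcoeff_msupp; apply: contra_neq_eq => mi.
have mE : m = (m - U_(i) + U_(i))%MM by rewrite submK // lep1mP.
have /eqP := mcoeff_deriv i (m - U_(i))%MM p.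
rewrite -mE dp mcoeff0 eq_sym -mulr_natr mulf_eq0.
by move/pcharf0P: charK0 => ->; rewrite orbF => /eqP.
Qed.


Lemma opM_sum (I : Type) (s : seq I) (c : I -> K) (r : R) (e : I -> nat) i j :
  segre_val r = \sum_(k <- s) c k *: segre_mon K i j ^+ e k ->
  opM r = \sum_(k <- s) c k *: opX K i j ^+ e k.
Proof.
move=> rE; apply: opEq => x /=.
rewrite diffop_sumE segre_val_sum rE mulr_suml; apply: eq_bigr => k _.
have opXn n : segre_val ((opX K i j ^+ n) x) =
    segre_mon K i j ^+ n * segre_val x.
  elim: n => [|n IHn]; first by rewrite mul1r.
  by rewrite !exprS -mulrA -IHn.
by rewrite -scalerAl -opXn.
Qed.

(** Since E_0k is x_0 times the derivative in x_k, in characteristic zero only x_0 and y_0 occur in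
    [r]. Equal degrees in x and y then force a polynomial in x_0 y_0; [s] lists its exponents and
    [n] is the largest. *)
Lemma highest_weight_sum (r : R) : r != 0 ->
  (forall k, k != ord0 -> opEx K b ord0 k r = 0) ->
  (forall l, l != ord0 -> opEy K a ord0 l r = 0) ->
  exists (s : seq nat) (c : nat -> K) n,
    opM r = \sum_(k <- s) c k *: opX K ord0 ord0 ^+ k /\
    [/\ uniq s, n \in s, c n != 0, (n <= msize (segre_val r))%N &
      forall k, k \in s -> (k <= n)%N].
Proof.
move=> r0 rx ry; pose p := segre_val r.
have p0 : p != 0 by apply: contra_neq r0 => p0; apply: val_inj.
have mulX_eq0 i (q : S) : 'X_i * q = 0 -> q = 0.
  move/eqP; rewrite mulf_eq0 => /orP[/eqP Xi|/eqP //].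
  by have := mmeasureX K mdeg U_(i)%MM; rewrite Xi mmeasure0.
have mx k m : k != ord0 -> m \in msupp p -> m (ix k) = 0%N.
  move=> k0; apply: mderiv0_exp; apply: (mulX_eq0 (ix ord0)).
  exact: (congr1 val (rx _ k0)).
have my l m : l != ord0 -> m \in msupp p -> m (iy l) = 0%N.
  move=> l0; apply: mderiv0_exp; apply: (mulX_eq0 (iy ord0)).
  exact: (congr1 val (ry _ l0)).
have mE m : m \in msupp p ->
    m = ((U_(ix ord0) + U_(iy ord0)) *+ m (ix ord0))%MM.
  move=> mp; have := segre_balanced (segre_valP r) mp.
  rewrite (bigD1 ord0) //= [RHS](bigD1 ord0) //=.
  rewrite !big1 ?addn0 => [mxy|l /my ->|k /mx ->] //; apply/mnmP => i.
  rewrite mulmnE mnmDE !mnm1E; case: (split_ordP i) => j ->.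
    rewrite eq_lshift eq_rlshift addn0.
    by have [<-|/eqP j0] := ord0 =P j; rewrite ?mul1n // mx // eq_sym.
  rewrite eq_lrshift eq_rshift add0n.
  by have [<-|/eqP j0] := ord0 =P j; rewrite ?mul1n -?mxy // my // eq_sym.
pose e0 := (U_(ix ord0) + U_(iy ord0))%MM.
pose ex (m : 'X_{1..a.+1 + b.+1}) := m (ix ord0).
pose s := [seq ex m | m <- msupp p]; pose c k := p@_(e0 *+ k).
have cE m : m \in msupp p -> c (ex m) = p@_m by move=> mp; rewrite /c -mE.
have exU m : m \in msupp p -> (ex m <= msize p)%N.
  move=> mp; apply: ltnW; apply: leq_ltn_trans (msize_mdeg_lt mp).
  by rewrite mdegE (bigD1 (ix ord0)) //= leq_addr.
have sU k : k \in s -> (k <= msize p)%N by case/mapP => m /exU mU ->.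
have [|n ns nmax] := ex_maxnP _ sU.
  exists (ex (mlead p)); apply/mapP; exists (mlead p) => //.
  exact: mlead_supp.
exists s, c, n; split.
  apply: opM_sum; rewrite big_map -/p {1}[p]mpolyE; apply: eq_big_seq => m mp.
  by rewrite cE // {2}(mE _ mp) segre_monE mpolyXn.
split=> //; last exact: sU.
  rewrite map_inj_in_uniq ?msupp_uniq // => m m' mp m'p exE.
  by rewrite (mE _ mp) (mE _ m'p) -!/(ex _) exE.
by case/mapP: ns => m mp ->; rewrite cE // -mcoeff_msupp.
Qed.

End Coefficients.

(** * From an annihilating operator to a contradiction *)

Section Annihilation.
Variables (K : fieldType) (a b : nat).
Local Notation R := (segre_ring K a b).
Local Notation D := (diffop R).
Local Notation ix := (@lshift a.+1 b.+1).
Local Notation iy := (@rshift a.+1 b.+1).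
Hypothesis charK0 : [pchar K] =i pred0.
Variables (M : lmodType D) (F : nat -> set M).
Hypotheses (F_le : forall n m, F n m -> F n.+1 m)
  (FD : forall n m m', F n m -> F n m' -> F n (m + m'))
  (FX : forall k l, raises F (opX K k l))
  (FEx : forall k m, raises F (opEx K b k m))
  (FEy : forall l m, raises F (opEy K a l m))
  (FV : forall k l, raises F (opV K k l)).
Variable J : nat.
Local Notation kills := (kills F J).

Lemma kills_opM_exists n e (d : D) : d != 0 -> diffop_le n d -> grows e d ->
  kills 0 d -> exists r : R, [/\ r != 0,
    (msize (segre_val r) <= 1 + e + 2 * (n.+1 * (a.+1 * b.+1)))%N &
    kills (n.+1 * (a.+1 * b.+1)) (opM r)].
Proof.
move=> d0 dn ge kd.
(* Each bracket with an X_kl costs one filtration step and raises the degree by at most 2. *)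
pose Q j (g : D) := kills j g /\ grows (e + 2 * j) g.
have [|||||||g [g0 [kg gg] gX]] := @common_kernel D ('I_a.+1 * 'I_b.+1)%type
    (fun p => ad (opX K p.1 p.2)) Q n.+1 0 d.
- by move=> p; apply: ad0.
- by move=> p q x; apply/ad_comm/opM_comm.
- move=> j x [kx gx]; split; first exact: killsS.
  by apply: grows_leq gx; lia.
- move=> p j x [kx gx]; split; first exact: kills_ad.
  by apply: grows_leq (grows_ad (grows_opX _ _) gx); lia.
- by move=> p; apply: iter_ad_opM.
- by [].
- by split=> //; apply: grows_leq ge; lia.
rewrite card_prod !card_ord add0n in kg gg.
have gE : g = opM (g 1) by apply: opM_eq => k l; apply: (gX (k, l)).
exists (g 1); split; last by rewrite -gE.
  apply: contra_neq g0 => g10; rewrite gE g10; apply: opEq => x /=.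
  by rewrite mul0r.
apply: leq_trans (gg 1) _.
by rewrite [segre_val 1]/(1 : {mpoly K[a.+1 + b.+1]}) msize1 addnA.
Qed.

(** The bracket of E_0k with the multiplication by [r] is the multiplication by E_0k applied to [r],
    so the common kernel is sought in R itself. The a+b operators commute, do not raise the degree,
    and vanish on [r] after [w] iterations. *)
Lemma kills_highest_weight j w (r : R) : r != 0 ->
  (msize (segre_val r) <= w)%N -> kills j (opM r) -> exists r' : R,
  [/\ r' != 0, (msize (segre_val r') <= w)%N, kills (j + w * (a + b)) (opM r'),
    forall k, k != ord0 -> opEx K b ord0 k r' = 0 &
    forall l, l != ord0 -> opEy K a ord0 l r' = 0].
Proof.
move=> r0 rw kr.
pose Q i (s : R) := kills i (opM s) /\ (msize (segre_val s) <= w)%N.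
pose T (i : 'I_a + 'I_b) : D := match i with
  | inl k => opEx K b ord0 (lift ord0 k)
  | inr l => opEy K a ord0 (lift ord0 l) end.
have T_comm i k : GRing.comm (T i) (T k).
  case: i k => [i|i] [k|k] /=; rewrite /GRing.comm.
  - rewrite opEx_opEx !(eq_sym _ ord0) !(negPf (neq_lift _ _)).
    by rewrite !mul0r subr0 addr0.
  - exact: opE_comm.
  - by rewrite -opE_comm.
  - rewrite opEy_opEy !(eq_sym _ ord0) !(negPf (neq_lift _ _)).
    by rewrite !mul0r subr0 addr0.
have [|||||||s [s0 [ks sw] Ts]] := @common_kernel R ('I_a + 'I_b)%type
    (fun i (s : R) => T i s) Q w j r.
- by move=> i; apply: diffop0.
- by move=> i k x; apply: (congr1 (fun g : D => g x) (T_comm i k)).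
- by move=> i x [kx xw]; split=> //; apply: killsS.
- move=> [k|k] i x [kx xw]; split.
  + by rewrite /= -ad_opEx_opM; apply: kills_ad.
  + by have := grows_opEx ord0 (lift ord0 k) x; rewrite addn0 => /leq_trans ->.
  + by rewrite /= -ad_opEy_opM; apply: kills_ad.
  + by have := grows_opEy ord0 (lift ord0 k) x; rewrite addn0 => /leq_trans ->.
- move=> i; apply: val_inj.
  have derw t : iter w (mderiv t) (segre_val r) = 0.
    apply/eqP; rewrite -msize_poly_eq0 -leqn0.
    by apply: leq_trans (msize_iter_mderiv _ _ _) _; rewrite leqn0 subn_eq0.
  have -> : val (iter w (fun s => T i s) r) = match i with
    | inl k => iter w (mvf (ix ord0) (ix (lift ord0 k))) (val r)
    | inr l => iter w (mvf (iy ord0) (iy (lift ord0 l))) (val r)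
    end by case: i => k; elim: w {rw Q derw} => //= w' ->.
  by case: i => k; rewrite iter_mulX_mderiv ?derw ?mulr0 // ?eq_rshift neq_lift.
- by [].
- by split.
rewrite card_sum !card_ord in ks.
exists s; split=> //.
- move=> k; case: (unliftP ord0 k) => [k' ->|->]; [|by rewrite eqxx].
  by move=> _; apply: (Ts (inl k')).
- move=> k; case: (unliftP ord0 k) => [k' ->|->]; [|by rewrite eqxx].
  by move=> _; apply: (Ts (inr k')).
Qed.

Lemma iter_adZ (v : D) n (c : K) d :
  iter n (ad v) (c *: d) = c *: iter n (ad v) d.
Proof.
elim: n => //= n ->; rewrite /ad -scalerAr -scalerAl -scalerBr //.
Qed.

(** With u = x_0 y_0 and the bracket of V_(0,l1) with u equal to E'_(0,l1), the n-fold bracket kills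
    the powers of u below the top exponent n and leaves the leading coefficient times n! E'^n. *)
Lemma kills_opEy_exp j w (r : R) (l1 : 'I_b.+1) : l1 != ord0 ->
  r != 0 -> (msize (segre_val r) <= w)%N -> kills j (opM r) ->
  (forall k, k != ord0 -> opEx K b ord0 k r = 0) ->
  (forall l, l != ord0 -> opEy K a ord0 l r = 0) ->
  exists2 n, (n <= w)%N & kills (j + n) (opEy K a ord0 l1 ^+ n).
Proof.
move=> l10 r0 rw kr rx ry.
have [s [c [n [rE [us ns cn0 nr smax]]]]] := highest_weight_sum charK0 r0 rx ry.
exists n; first exact: leq_trans nr rw.
have lneq : ord0 != l1 by rewrite eq_sym.
have adE : ad (opV K ord0 l1) (opX K ord0 ord0) = opEy K a ord0 l1.
  exact: ad_opV_opX.
have vC : GRing.comm (opV K ord0 l1) (opEy K a ord0 l1) by apply: comm_opEy_opV.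
have xC : GRing.comm (opX K ord0 ord0) (opEy K a ord0 l1).
  exact: comm_opEy_opX.
have := kills_iter_ad (n := n) (FV ord0 l1) kr.
rewrite rE iter_ad_sum (bigD1_seq n) //= big1_seq ?addr0; last first.
  move=> k /andP[kn ks]; rewrite iter_adZ iter_ad_expn_lt ?adE ?scaler0 //.
  by rewrite ltn_neqAle kn smax.
rewrite iter_adZ iter_ad_expn adE // => kcE.
apply: (kills_natr charK0 (fact_gt0 n)).
have := kills_mull (c n)^-1%:A kcE.
by rewrite mulr_algl scalerA mulVf // scale1r.
Qed.

(** With P = (a+1)(b+1), the budget is (n+1)P steps for the brackets with X_kl, w(a+b) for the E_0k
    and E'_0l, w for reaching E'_(0,l1), 3w for spreading nilpotency, and wP + 1 for finding [m2]
    from the vector in step [j0]. Here [w] bounds the degree of the function reached. *)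
Lemma annihilator_bound (a_ge1 : (0 < a)%N) (b_ge1 : (0 < b)%N)
    n e j0 (d : D) (m : M) (w := (1 + e + 2 * (n.+1 * (a.+1 * b.+1)))%N) :
  d != 0 -> diffop_le n d -> grows e d -> kills 0 d -> m != 0 -> F j0 m ->
  (j0 + 1 + n.+1 * (a.+1 * b.+1) + w * (a.+1 * b.+1 + (a + b) + 4) <= J)%N ->
  False.
Proof.
move=> d0 dn ge kd m0 Fm leJ.
have [r [r0 rw kr]] := kills_opM_exists d0 dn ge kd.
have [r' [r'0 r'w kr' rx ry]] := kills_highest_weight r0 rw kr.
have [l1 l10] : exists l1 : 'I_b.+1, l1 != ord0.
  by case: (b) b_ge1 => // b' _; apply: neq_exists.
have [p pw kE] := kills_opEy_exp l10 r'0 r'w kr' rx ry.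
rewrite eq_sym in l10.
apply: (nilpotent_false charK0 F_le FD FX FEx FV m0 Fm
  (nilpotent_spread charK0 FX FV a_ge1 l10 kE)).
apply: leq_trans leJ; rewrite -/w.
nia.
Qed.

End Annihilation.

(** * A large independent family of operators *)

Section Derivations.
Variables (K : fieldType) (A : comAlgType K).
Implicit Types (d e : diffop A) (r s : A).

Definition derivation d := forall r s, d (r * s) = d r * s + r * d s.

Lemma diffop_subE d e r : (d - e) r = d r - e r.
Proof. by []. Qed.

Lemma diffop_mulE d e r : (d * e) r = d (e r).
Proof. by []. Qed.

Lemma derivationB d e : derivation d -> derivation e -> derivation (d - e).
Proof. by move=> dd de r s; rewrite !diffop_subE dd de; ring. Qed.

Lemma derivation_sum (X : Type) (t : seq X) (d : X -> diffop A) :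
  (forall x, derivation (d x)) -> derivation (\sum_(x <- t) d x).
Proof.
move=> dd r s; rewrite !diffop_sumE mulr_suml mulr_sumr -big_split /=.
by apply: eq_bigr => x _; apply: dd.
Qed.

Lemma derivation1 d : derivation d -> d 1 = 0.
Proof.
move/(_ 1 1)/eqP; rewrite !mulr1 mul1r -subr_eq0 opprD addNKr oppr_eq0.
by move/eqP.
Qed.

Lemma derivationX d r (k : A) n : derivation d -> d r = k * r ->
  d (r ^+ n) = n%:R * k * r ^+ n.
Proof.
move=> dd dr; elim: n => [|n IHn]; first by rewrite derivation1 // !mul0r.
by rewrite exprS dd IHn dr -natr1; ring.
Qed.

Lemma derivation_prodX (X : eqType) (t : seq X) (g : X -> A)
    (c : X -> nat) d x :
  derivation d -> (forall y, d (g y) = (x == y)%:R * g y) ->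
  d (\prod_(y <- t) g y ^+ c y) =
  (\sum_(y <- t) (x == y) * c y)%N%:R * \prod_(y <- t) g y ^+ c y.
Proof.
move=> dd dg; elim: t => [|y t IHt].
  by rewrite !big_nil derivation1 ?mul0r.
rewrite !big_cons dd IHt (derivationX _ dd (dg y)) natrD natrM; ring.
Qed.

(* On an eigenvector of [h] with eigenvalue [n] in [nat], [falling h k] acts
   as [n (n - 1) ... (n - k + 1)]. *)
Fixpoint falling (h : diffop A) k : diffop A :=
  if k is k'.+1 then (h - k'%:R) * falling h k' else 1.

Lemma natr_diffopE k r : (k%:R : diffop A) r = k%:R * r.
Proof.
elim: k => [|k IHk]; first by rewrite mul0r.
by rewrite -[k.+1]addn1 !natrD mulrDl mul1r -IHk.
Qed.

Lemma fallingE (h : diffop A) n k r : h r = n%:R * r ->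
  falling h k r = (n ^_ k)%:R * r.
Proof.
move=> hr; elim: k => [|k IHk]; first by rewrite ffactn0 mul1r.
rewrite -[LHS]/((h - k%:R) (falling h k r)) IHk diffop_subE natr_diffopE.
have [lt_nk|le_kn] := ltnP n k.
  rewrite !ffact_small ?ltnS ?(ltnW lt_nk) // !mul0r mulr0 subr0.
  by rewrite diffop0.
have -> : h ((n ^_ k)%:R * r) = (n ^_ k)%:R * h r.
  have -> : (n ^_ k)%:R * r = (n ^_ k)%:R *: r by rewrite scaler_nat mulr_natl.
  by rewrite diffopZ scaler_nat mulr_natl.
by rewrite hr ffactnSr natrM natrB //; ring.
Qed.

End Derivations.

Section IndependentOperators.
Variables (K : fieldType) (a b : nat).
Hypothesis charK0 : [pchar K] =i pred0.
Local Notation R := (segre_ring K a b).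
Local Notation D := (diffop R).
Local Notation I := ('I_a.+1 + 'I_b)%type.

(* The rays [x_k y_0] and [x_0 y_l], l > 0, span a simplicial cone of full
   dimension inside the (non-simplicial) Segre cone. *)
Definition ray (i : I) : R := match i with
  | inl k => segre_gen K k ord0
  | inr l => segre_gen K ord0 (lift ord0 l) end.

(** The derivation that reads off the exponent of the ray [i]. The degree in x_0 counts x_0 y_0
    together with every x_0 y_l, whence the correction at [ord0]. *)
Definition ray_euler (i : I) : D := match i with
  | inl k => opEx K b k k -
     (if k == ord0 then \sum_(l < b) opEy K a (lift ord0 l) (lift ord0 l)
      else 0)
  | inr l => opEy K a (lift ord0 l) (lift ord0 l) end.

Lemma opEx_derivation (k m : 'I_a.+1) : derivation (opEx K b k m).
Proof. by move=> r s; apply: val_inj; rewrite /= mvfM. Qed.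

Lemma opEy_derivation (k m : 'I_b.+1) : derivation (opEy K a k m).
Proof. by move=> r s; apply: val_inj; rewrite /= mvfM. Qed.

Lemma derivation0 : derivation (0 : D).
Proof.
by move=> r s; rewrite -[RHS]/(0 * s + r * 0) mul0r mulr0 addr0.
Qed.

Lemma ray_euler_derivation i : derivation (ray_euler i).
Proof.
case: i => [k|l]; last exact: opEy_derivation.
apply: derivationB; first exact: opEx_derivation.
case: ifP => _; last exact: derivation0.
by apply: derivation_sum => l; apply: opEy_derivation.
Qed.

Lemma ray_euler_ray i j : ray_euler i (ray j) = (i == j)%:R * ray j.
Proof.
have lift0 n (l : 'I_n) : (lift ord0 l == ord0) = false.
  by rewrite eq_sym (negPf (neq_lift _ _)).
case: i j => [k|l] [k'|l']; last 2 first.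
- by rewrite [LHS]opEy_gen lift0 [RHS]mul0r mul0r.
- have -> : (inr l == inr l' :> I) = (l == l') by [].
  rewrite [LHS]opEy_gen (inj_eq lift_inj).
  by have [->|_] := eqVneq l l'; rewrite ?mul0r.
- have -> : (inl k == inl k' :> I) = (k == k') by [].
  rewrite /ray_euler diffop_subE /ray opEx_gen.
  suff -> : (if k == ord0 then \sum_(l < b) opEy K a (lift ord0 l) (lift ord0 l)
      else 0) (segre_gen K k' ord0) = 0.
    by rewrite subr0; have [->|_] := eqVneq k k'; rewrite ?mul0r.
  case: ifP => // _; rewrite diffop_sumE big1 // => l _.
  by rewrite opEy_gen lift0 mul0r.
- rewrite [RHS]mul0r /ray_euler diffop_subE /ray opEx_gen.
  case: eqP => [->|_]; last by rewrite mul0r subr0.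
  rewrite mul1r diffop_sumE (bigD1 l') // opEy_gen eqxx mul1r.
  rewrite big1 => [/=|l /negPf ll']; first by rewrite addr0 subrr.
  by rewrite opEy_gen (inj_eq lift_inj) ll' mul0r.
Qed.

Definition ray_mon (c : I -> nat) : R := \prod_i ray i ^+ c i.

Lemma ray_euler_mon i c : ray_euler i (ray_mon c) = (c i)%:R * ray_mon c.
Proof.
rewrite (derivation_prodX _ _ (ray_euler_derivation i) (ray_euler_ray i)).
congr (_%:R * _); rewrite (bigD1 i) //= eqxx mul1n big1 ?addn0 // => j.
by rewrite eq_sym => /negPf ->.
Qed.

Lemma segre_natr n : segre_val (n%:R : R) = n%:R.
Proof. by elim: n => // n IHn; rewrite -natr1 -[n.+1]addn1 natrD -IHn. Qed.

Lemma ray_mon_exp c : exists m, segre_val (ray_mon c) = 'X_[m].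
Proof.
rewrite /ray_mon.
apply: (big_ind (fun r : R => exists m, segre_val r = 'X_[m])).
- by exists 0%MM; rewrite mpolyX0.
- by move=> r s [m rE] [m' sE]; exists (m + m')%MM; rewrite mpolyXD -rE -sE.
- move=> i _; have [m rE] : exists m, segre_val (ray i) = 'X_[m].
    by case: i => [k|l]; eexists; apply: segre_monE.
  exists (m *+ c i)%MM; rewrite -mpolyXn -rE.
  by elim: (c i) => // n IHn; rewrite !exprS -IHn.
Qed.

Lemma ray_mon_neq0 c : segre_val (ray_mon c) != 0.
Proof.
have [m ->] := ray_mon_exp c; rewrite -msize_poly_eq0.
by rewrite mmeasureX.
Qed.

(** The exponents are eigenvalues of the [ray_euler i], and natural numbers are distinct in K. *)
Lemma ray_mon_inj c c' :
  segre_val (ray_mon c) = segre_val (ray_mon c') -> c =1 c'.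
Proof.
move=> cc' i; have := ray_euler_mon i c'.
rewrite -(val_inj cc') ray_euler_mon => /(congr1 val)/(mulIf (ray_mon_neq0 _)).
rewrite /= !segre_natr -!mpolyC_nat => /eqP; rewrite mpolyC_eq.
rewrite -subr_eq0 => /eqP ccK.
wlog le_cc' : c c' cc' ccK / (c i <= c' i)%N => [hw|].
  have [/hw ->//|/ltnW/hw ->//] := leqP (c i) (c' i).
  by rewrite -opprB ccK oppr0.
apply/eqP; rewrite eqn_leq le_cc' /= -subn_eq0.
move/pcharf0P: charK0 => <-; rewrite natrB //.
by rewrite -oppr_eq0 opprB ccK.
Qed.

Lemma ray_mon_free (N : nat) (c : {ffun I -> 'I_N} -> K) :
  \sum_e c e *: segre_val (ray_mon (fun i => e i)) = 0 -> forall e, c e = 0.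
Proof.
move=> sum0 e0; have [m mE] := ray_mon_exp (fun i => e0 i).
have := congr1 (mcoeff m) sum0; rewrite mcoeff0 raddf_sum (bigD1 e0) //=.
rewrite mcoeffZ mE mcoeffX eqxx mulr1 big1 ?addr0 // => e ee0.
have [m' m'E] := ray_mon_exp (fun i => e i).
rewrite mcoeffZ m'E mcoeffX; case: eqP => [mm'|_]; last by rewrite mulr0.
case/eqP: ee0; apply/ffunP => i; apply: val_inj.
by apply: (@ray_mon_inj (fun i => e i) (fun i => e0 i)); rewrite mE m'E mm'.
Qed.

(** The system is triangular: at [p = e] the term of [e'] vanishes unless [e' <= e] entrywise, and
    the diagonal entry is a product of factorials, nonzero in characteristic zero. *)
Lemma ffact_free (N : nat) (c : {ffun I -> 'I_N} -> K) :
  (forall p : I -> nat, \sum_e c e * (\prod_i (p i) ^_ (e i))%N%:R = 0) ->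
  forall e, c e = 0.
Proof.
move=> sum0 e; have [n] := ubnP (\sum_i e i)%N; elim: n e => // n IHn e lt_en.
have := sum0 (fun i => e i).
rewrite (bigD1 e) //= [X in _ + X]big1 => [|e' e'e].
  rewrite /= addr0 => /eqP; rewrite mulf_eq0 => /orP[/eqP //|].
  move/pcharf0P: charK0 => ->; rewrite eqn0Ngt.
  by rewrite prodn_gt0 // => i; rewrite ffactnn fact_gt0.
have [/forallP le_e'e|] := boolP [forall i, (e' i <= e i)%N]; last first.
  rewrite negb_forall => /existsP[i]; rewrite -ltnNge => lt_ee'.
  by rewrite (bigD1 i) //= ffact_small // mul0n mulr0.
rewrite IHn ?mul0r //; apply: leq_trans (_ : _ <= \sum_i e i)%N lt_en.
have [i lt_i] : exists i, (e' i < e i)%N.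
  apply/existsP; apply: contraNT e'e; rewrite negb_exists => /forallP le_ee'.
  apply/eqP/ffunP => i; apply/val_inj/eqP; rewrite eqn_leq le_e'e /=.
  by rewrite leqNgt le_ee'.
rewrite (bigD1 i) //= [X in (_ < X)%N](bigD1 i) //=.
by rewrite -addSn leq_add // leq_sum.
Qed.

(** The analogue of the Weyl algebra monomials x^e d^f: it multiplies a ray monomial by another one
    and by a product of falling factorials of its exponents. *)
Definition ray_op (N : nat) (x : {ffun I -> 'I_N} * {ffun I -> 'I_N}) : D :=
  opM (ray_mon (fun i => x.1 i)) *
  \prod_(i <- enum {: I}) falling (ray_euler i) (x.2 i).

Lemma ray_op_mon N (x : {ffun I -> 'I_N} * {ffun I -> 'I_N}) p :
  segre_val (ray_op x (ray_mon p)) = (\prod_i (p i) ^_ (x.2 i))%N%:R *: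
  (segre_val (ray_mon (fun i => x.1 i)) * segre_val (ray_mon p)).
Proof.
have prodE (s : seq I) :
    (\prod_(i <- s) falling (ray_euler i) (x.2 i)) (ray_mon p) =
    (\prod_(i <- s) (p i) ^_ (x.2 i))%N%:R * ray_mon p.
  elim: s => [|i s IHs]; first by rewrite !big_nil mul1r.
  rewrite !big_cons diffop_mulE IHs.
  set n := (\prod_(j <- s) _)%N.
  have -> : n%:R * ray_mon p = n%:R *: ray_mon p.
    by rewrite scaler_nat mulr_natl.
  rewrite diffopZ (fallingE _ (ray_euler_mon i p)).
  by rewrite scaler_nat -mulrnAl -[_ *+ _]mulr_natr -natrM mulnC.
rewrite /ray_op diffop_mulE prodE /=.
rewrite segre_natr big_enum /= scaler_nat -mulr_natl; ring.
Qed.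

(** On a fixed ray monomial the first indices are separated by independence of monomials; varying
    that monomial, the second ones are separated by [ffact_free]. *)
Lemma ray_op_free N (c : {ffun I -> 'I_N} * {ffun I -> 'I_N} -> K) :
  \sum_x c x *: ray_op x = 0 -> forall x, c x = 0.
Proof.
move=> sum0 [e f]; move: f; apply: ffact_free => p.
move: e; apply: ray_mon_free.
have := congr1 (fun d : D => segre_val (d (ray_mon p))) sum0.
rewrite /= diffop_sumE.
rewrite segre_val_sum.
have opE x : segre_val ((c x *: ray_op x) (ray_mon p)) =
    (c x * (\prod_i (p i) ^_ (x.2 i))%N%:R) *:
     (segre_val (ray_mon (fun i => x.1 i)) * segre_val (ray_mon p)).
  have scE (d : D) k : segre_val ((k *: d) (ray_mon p)) =
    k *: segre_val (d (ray_mon p)) by [].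
  by rewrite scE ray_op_mon scalerA.
rewrite (eq_bigr _ (fun x _ => opE x)).
under eq_bigr do rewrite scalerAl.
rewrite -mulr_suml => /eqP; rewrite mulf_eq0 (negPf (ray_mon_neq0 _)) orbF.
move/eqP => sumx0; rewrite -[RHS]sumx0.
under eq_bigr do rewrite scaler_suml.
by rewrite pair_bigA; apply: eq_bigr => -[e f].
Qed.

Local Notation rk := (a.+1 + b)%N.

Lemma diffop_le0 n : diffop_le n (0 : D).
Proof. by apply: diffop_le_leq (leq0n n) _; exists 0 => x; rewrite mul0r. Qed.

Lemma diffop_le_sum n (X : Type) (s : seq X) (e : X -> D) :
  (forall x, diffop_le n (e x)) -> diffop_le n (\sum_(x <- s) e x).
Proof.
move=> en; apply: (big_ind (fun x : D => diffop_le n x)) => //.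
  exact: diffop_le0.
by move=> x y xn yn; apply: diffop_leD.
Qed.

Lemma diffop_leM n n' (x y : D) :
  diffop_le n x -> diffop_le n' y -> diffop_le (n + n') (x * y).
Proof. exact: diffop_le_comp. Qed.

Lemma diffop_leB n (x y : D) :
  diffop_le n x -> diffop_le n y -> diffop_le n (x - y).
Proof. by move=> xn yn; apply: (diffop_leD xn (diffop_leN yn)). Qed.

Lemma diffop_le1 : diffop_le 0 (1 : D).
Proof. by exists 1 => x; rewrite mul1r. Qed.

Lemma diffop_le_natr n : diffop_le 0 (n%:R : D).
Proof. by exists n%:R => x; rewrite natr_diffopE. Qed.

Lemma opM_le (r : R) : diffop_le 0 (opM r).
Proof. by exists r => x; apply: val_inj. Qed.

Lemma opEx_le (k m : 'I_a.+1) : diffop_le 1 (opEx K b k m).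
Proof. exact/restrict_le/mvf_le. Qed.

Lemma opEy_le (k m : 'I_b.+1) : diffop_le 1 (opEy K a k m).
Proof. exact/restrict_le/mvf_le. Qed.

Lemma opV_le (k : 'I_a.+1) (l : 'I_b.+1) : diffop_le 2 (opV K k l).
Proof. exact/restrict_le/dxy_le. Qed.

Lemma ray_euler_le i : diffop_le 1 (ray_euler i).
Proof.
case: i => [k|l]; last exact: opEy_le.
rewrite /ray_euler; apply: diffop_leB; first exact: opEx_le.
case: ifP => _; last exact: diffop_le0.
by apply: diffop_le_sum => l; apply: opEy_le.
Qed.

Lemma falling_le (h : D) k : diffop_le 1 h -> diffop_le k (falling h k).
Proof.
move=> h1; elim: k => [|k IHk]; first exact: diffop_le1.
apply: (diffop_leM (n := 1)) => //; apply: diffop_leB => //.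
exact/diffop_leS/diffop_le_natr.
Qed.

Lemma ray_op_le N x : diffop_le (rk * N) (@ray_op N.+1 x).
Proof.
rewrite -[(rk * N)%N]add0n; apply: diffop_leM; first exact: opM_le.
have -> : (rk * N = size (enum {: I}) * N)%N.
  by rewrite -cardE card_sum !card_ord.
elim: (enum _) => [|i s IHs]; first by rewrite big_nil; exact: diffop_le1.
rewrite big_cons /= mulSn; apply: diffop_leM => //.
by apply: diffop_le_leq (falling_le _ (ray_euler_le i)); rewrite -ltnS.
Qed.

Lemma grows_sum e (X : Type) (s : seq X) (g : X -> D) :
  (forall x, grows e (g x)) -> grows e (\sum_(x <- s) g x).
Proof.
move=> ge; apply: (big_ind (grows e)) => //; first exact: grows0.
by move=> x y gx gy; apply: growsD.
Qed.

Lemma grows_ray_euler i : grows 0 (ray_euler i).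
Proof.
case: i => [k|l]; last exact: grows_opEy.
rewrite /ray_euler; apply: growsD; first exact: grows_opEx.
apply: growsN; case: ifP => _; last exact: grows0.
by apply: grows_sum => l; apply: grows_opEy.
Qed.

Lemma grows_natr n : grows 0 (n%:R : D).
Proof.
elim: n => [|n IHn]; first exact: grows0.
by rewrite -natr1; apply: growsD => //; apply: grows1.
Qed.

Lemma grows_falling (h : D) k : grows 0 h -> grows 0 (falling h k).
Proof.
move=> h0; elim: k => [|k IHk]; first exact: grows1.
rewrite -[0%N]addn0; apply: growsM => //; apply: growsD => //.
exact/growsN/grows_natr.
Qed.

Lemma opM1 : opM (1 : R) = 1.
Proof. by apply: opEq => r; rewrite /= mul1r. Qed.

Lemma opMM (r s : R) : opM (r * s) = opM r * opM s.
Proof. by apply: opEq => x; rewrite /= mulrA. Qed.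

(** Serves both for the growth of degrees, with [e] = 2, and for the filtration steps, with [e] =
    1. *)
Lemma ray_mon_ind (P : nat -> D -> Prop) e N (c : {ffun I -> 'I_N.+1}) :
  (forall k k' x, (k <= k')%N -> P k x -> P k' x) -> P 0 1 ->
  (forall k k' x y, P k x -> P k' y -> P (k + k')%N (x * y)) ->
  (forall i, P e (opM (ray i))) ->
  P (rk * N * e)%N (opM (ray_mon (fun i => c i))).
Proof.
move=> Pm P1 PM Pray.
have -> : (rk * N = #|{: I}| * N)%N by rewrite card_sum !card_ord.
rewrite /ray_mon -big_enum cardE; elim: (enum _) => [|i s IHs].
  by rewrite big_nil opM1.
rewrite big_cons opMM /= mulSn mulnDl; apply: (@PM _ _) => //.
apply: (@Pm (c i * e)%N); first by rewrite leq_mul2r -ltnS ltn_ord orbT.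
elim: (nat_of_ord (c i)) => [|n IHn]; first by rewrite opM1.
by rewrite exprS opMM mulSn; apply: (@PM _ _).
Qed.

Lemma grows_ray_op N x : grows (rk * N * 2) (@ray_op N.+1 x).
Proof.
rewrite -[(rk * N * 2)%N]addn0; apply: growsM.
  apply: (@ray_mon_ind (@grows K a b) 2 N x.1); try exact: grows1.
  - by move=> k k' g; apply: grows_leq.
  - exact: growsM.
  - by case=> [k|l]; apply: grows_opX.
elim: (enum _) => [|i s IHs]; first by rewrite big_nil; exact: grows1.
rewrite big_cons -[0%N]addn0; apply: growsM => //.
exact/grows_falling/grows_ray_euler.
Qed.

End IndependentOperators.

(** * Growth of module filtrations *)

Section Pigeonhole.
Variables (K : fieldType) (V : lmodType K).

Definition has_indep (W : set V) n :=
  exists u : 'I_n -> V, (forall i, W (u i)) /\ lin_indep u.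

(** A maximal independent family in [W]: adjoining [w] creates a relation, which can be solved for
    [w]. *)
Lemma spanning_family (W : set V) q : ~ has_indep W q ->
  exists p (u : 'I_p -> V), [/\ (p < q)%N, forall i, W (u i) &
    forall w, W w -> exists c : 'I_p -> K, w = \sum_i c i *: u i].
Proof.
move=> nq; have [p [lt_pq [u [uW uI]] np]] : exists p,
    [/\ (p < q)%N, has_indep W p & ~ has_indep W p.+1].
  elim: q nq => [[]|q IHq nq].
    by exists (fun=> 0); split; [case|move=> c _; case].
  have [Wq|/IHq [p [lt_pq Wp np]]] := pselect (has_indep W q).
    by exists q.
  by exists p; split=> //; apply: leqW.
exists p, u; split=> // w Ww; apply: contrapT => nspan; apply: np.
exists (fun i => if unlift ord0 i is Some j then u j else w); split.
  by move=> i; case: unlift.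
move=> c; rewrite big_ord_recl unlift_none.
under eq_bigr do rewrite liftK.
move=> c0; have [c00|c0n0] := eqVneq (c ord0) 0.
  move: c0; rewrite c00 scale0r add0r => /uI cl i.
  by case: (unliftP ord0 i) => [j ->|->].
case: nspan; exists (fun j => - (c ord0)^-1 * c (lift ord0 j)).
under eq_bigr do rewrite -scalerA.
move/eqP: c0; rewrite addrC addr_eq0 => /eqP uE.
by rewrite -scaler_sumr uE scaleNr scalerN opprK scalerA mulVf // scale1r.
Qed.

Lemma linear_dependence (X Y : finType) (g : X -> Y -> K) :
  (#|Y| < #|X|)%N -> exists c : X -> K, (exists x, c x != 0) /\
    forall y, \sum_x c x * g x y = 0.
Proof.
move=> ltYX; pose A := \matrix_(k < #|X|, l < #|Y|) g (enum_val k) (enum_val l).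
have /rowV0Pn [v /sub_kermxP vA v0] : kermx A != 0.
  rewrite -mxrank_eq0 mxrank_ker -lt0n subn_gt0.
  exact: leq_ltn_trans (rank_leq_col _) ltYX.
exists (fun x => v 0 (enum_rank x)); split.
  have [k vk] : exists k, v 0 k != 0.
    apply/existsP; apply: contra_neqT v0; rewrite negb_exists => /forallP v0.
    by apply/rowP => k; rewrite mxE; apply/eqP; move: (v0 k); rewrite negbK.
  by exists (enum_val k); rewrite enum_valK.
move=> y; transitivity ((v *m A) 0 (enum_rank y)); last by rewrite vA mxE.
rewrite mxE (reindex_onto enum_val enum_rank) /=; last first.
  by move=> x _; apply: enum_rankK.
rewrite (eq_bigl xpredT); last by move=> k; rewrite enum_valK eqxx.
by apply: eq_bigr => k _; rewrite mxE enum_valK enum_rankK.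
Qed.

(** On spanning families of fewer than [q] vectors each operator is given by fewer than [q * q]
    matrix entries, so the operators are dependent on [W1]. *)
Lemma operator_pigeonhole (W1 W2 : set V) q (X : finType) (T : X -> V -> V) :
  ~ has_indep W1 q -> ~ has_indep W2 q -> (q * q <= #|X|)%N ->
  (forall x, linear (T x)) -> (forall x w, W1 w -> W2 (T x w)) ->
  exists c : X -> K, (exists x, c x != 0) /\
    forall w, W1 w -> \sum_x c x *: T x w = 0.
Proof.
move=> n1 n2 leX linT TW.
have [p1 [u1 [lt_p1 u1W span1]]] := spanning_family n1.
have [p2 [u2 [lt_p2 _ span2]]] := spanning_family n2.
have coordP x i : exists c : 'I_p2 -> K, T x (u1 i) = \sum_j c j *: u2 j.
  exact/span2/TW.
pose coord x i := projT1 (cid (coordP x i)).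
have coordE x i : T x (u1 i) = \sum_j coord x i j *: u2 j.
  exact: projT2 (cid (coordP x i)).
have [|c [c0 cg]] := @linear_dependence X ('I_p1 * 'I_p2)%type
    (fun x ij => coord x ij.1 ij.2).
  by rewrite card_prod !card_ord; apply: leq_trans leX; apply: ltn_mul.
exists c; split=> //.
have sumT0 i : \sum_x c x *: T x (u1 i) = 0.
  under eq_bigr do rewrite coordE scaler_sumr.
  rewrite exchange_big big1 // => j _.
  under eq_bigr do rewrite scalerA.
  by rewrite -scaler_suml (cg (i, j)) scale0r.
move=> w /span1 [e ->].
have linT' x : T x (\sum_i e i *: u1 i) = \sum_i e i *: T x (u1 i).
  apply: (big_rec2 (fun y z => T x y = z)) => [|i y z _ <-]; last exact: linT.
  by have := linT x (-1) 0 0; rewrite scaler0 addr0 scaleN1r addNr.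
under eq_bigr do rewrite linT' scaler_sumr.
rewrite exchange_big big1 // => i _.
transitivity (e i *: \sum_x c x *: T x (u1 i)).
  rewrite scaler_sumr.
  by apply: eq_bigr => x _; rewrite !scalerA mulrC.
by rewrite sumT0 scaler0.
Qed.

End Pigeonhole.

(** The budget of [annihilator_bound] for order rN and degree 2rN, plus the 2rN steps by which
    [ray_op] raises the filtration, is at most linear in N. *)
Lemma linear_bound j0 r P Q N
  (w := (1 + r * N * 2 + 2 * ((r * N).+1 * P))%N)
  (W := (1 + r * 2 + 2 * (r.+1 * P))%N) :
  (j0 + 1 + (r * N).+1 * P + w * Q + (r * N + r * N) <=
   (j0 + 1 + r.+1 * P + W * Q + (r + r)) * N.+1)%N.
Proof.
have le_n : ((r * N).+1 <= r.+1 * N.+1)%N by rewrite mulSn mulnS; lia.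
have le_rN : (r * N <= r * N.+1)%N by rewrite leq_mul2l leqnSn orbT.
have le_nP : ((r * N).+1 * P <= r.+1 * P * N.+1)%N.
  by rewrite [leqRHS]mulnAC leq_mul2r le_n orbT.
have le_w : (w <= W * N.+1)%N.
  rewrite /w /W (mulnDl (1 + r * 2)%N) (mulnDl 1%N) mul1n.
  apply: leq_add; first apply: leq_add => //.
    by rewrite [leqRHS]mulnAC leq_mul2r le_rN orbT.
  by rewrite -[leqRHS]mulnA leq_mul2l le_nP orbT.
have le_wQ : (w * Q <= W * Q * N.+1)%N.
  by rewrite [leqRHS]mulnAC leq_mul2r le_w orbT.
rewrite (mulnDl (j0 + 1 + r.+1 * P + W * Q)%N)
  (mulnDl (j0 + 1 + r.+1 * P)%N).
rewrite (mulnDl (j0 + 1)%N) (mulnDl r).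
by do !apply: leq_add => //; rewrite leq_pmulr.
Qed.

Section Growth.
Variables (K : fieldType) (a b : nat).
Local Notation R := (segre_ring K a b).
Local Notation D := (diffop R).
Hypothesis charK0 : [pchar K] =i pred0.
Variables (M : lmodType D) (F : nat -> set M).
Local Notation MK := (restr_scalars M).
Hypotheses (F_le : forall n m, F n m -> F n.+1 m)
  (F_sub : forall n, submod_closed (mem (F n : set MK)))
  (FX : forall k l, raises F (opX K k l))
  (FEx : forall k m, raises F (opEx K b k m))
  (FEy : forall l m, raises F (opEy K a l m))
  (FV : forall k l, raises F (opV K k l)).
Local Notation rk := (a.+1 + b)%N.
Local Notation I := ('I_a.+1 + 'I_b)%type.

Definition raises_by k (d : D) := forall n m, F n m -> F (n + k)%N (d *: m).

Lemma F_lin n (c : K) (x y : MK) :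
  F n (x : M) -> F n (y : M) -> F n (c *: x + y : MK).
Proof.
move=> Fx Fy; have [_ lF] := F_sub n.
by have := lF c x y; rewrite !in_setE; apply.
Qed.

Lemma F_add n (x y : M) : F n x -> F n y -> F n (x + y).
Proof.
by move=> Fx Fy; have := F_lin 1 Fx Fy; rewrite [1 *: _]scale1r.
Qed.

Lemma F_opp n (x : M) : F n x -> F n (- x).
Proof.
have [F0 _] := F_sub n; rewrite in_setE in F0.
by move=> Fx; have := F_lin (-1) Fx F0; rewrite addr0 [_ *: _]scaleN1r.
Qed.

Lemma raises_byM k k' d d' :
  raises_by k d -> raises_by k' d' -> raises_by (k + k') (d * d').
Proof.
by move=> dF d'F n m Fm; rewrite -scalerA addnA addnAC; apply/dF/d'F.
Qed.

Lemma raisesB d d' : raises F d -> raises F d' -> raises F (d - d').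
Proof.
move=> dF d'F n m Fm; rewrite scalerBl; apply: F_add; first exact: dF.
exact/F_opp/d'F.
Qed.

Lemma raises0 : raises F 0.
Proof.
move=> n m _; rewrite scale0r; have [F0 _] := F_sub n.+1.
by rewrite in_setE in F0.
Qed.

Lemma raises_natr k : raises F k%:R.
Proof.
elim: k => [|k IHk]; first exact: raises0.
move=> n m Fm; rewrite -natr1 scalerDl scale1r; apply: F_add; first exact: IHk.
exact: F_le.
Qed.

Lemma raises_sum (X : Type) (s : seq X) (d : X -> D) :
  (forall x, raises F (d x)) -> raises F (\sum_(x <- s) d x).
Proof.
move=> dF; apply: (big_ind (raises F)) => //; first exact: raises0.
move=> x y xF yF n m Fm; rewrite scalerDl.
by apply: F_add; [apply: xF|apply: yF].
Qed.

Lemma raises_ray_euler i : raises F (@ray_euler K a b i).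
Proof.
case: i => [k|l]; last exact: FEy.
rewrite /ray_euler; apply: raisesB; first exact: FEx.
case: ifP => _; last exact: raises0.
by apply: raises_sum => l; apply: FEy.
Qed.

Lemma raises_falling (h : D) k : raises F h -> raises_by k (falling h k).
Proof.
move=> hF; elim: k => [|k IHk].
  by move=> n m; rewrite scale1r addn0.
rewrite -add1n; apply: raises_byM => // n m; rewrite addn1.
by apply: raisesB => //; apply: raises_natr.
Qed.

Lemma raises_ray_op N x : raises_by (rk * N + rk * N) (@ray_op K a b N.+1 x).
Proof.
have P1 : raises_by 0 1 by move=> n m; rewrite scale1r addn0.
have Pm k k' d : (k <= k')%N -> raises_by k d -> raises_by k' d.
  by move=> kk' dF n m /dF; apply: (ascending_leq F_le); rewrite leq_add2l.
apply: raises_byM.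
  rewrite -[(rk * N)%N]muln1.
  apply: (@ray_mon_ind _ _ _ raises_by 1 N x.1) => //.
    exact: raises_byM.
  by case=> [k|l] n m; rewrite addn1; apply: FX.
have -> : (rk * N = size (enum {: I}) * N)%N.
  by rewrite -cardE card_sum !card_ord.
elim: (enum _) => [|i s IHs]; first by rewrite big_nil.
rewrite big_cons /= mulSn; apply: raises_byM => //.
apply: Pm (raises_falling _ (raises_ray_euler i)).
by rewrite -ltnS.
Qed.

(** If F^(J') were too small, so would be F^J, and some nontrivial combination of the (N+1)^(2 rk)
    operators [ray_op], which map F^J to F^(J'), would kill F^J. It is nonzero by independence,
    against [annihilator_bound]. *)
Lemma growth (a_ge1 : (0 < a)%N) (b_ge1 : (0 < b)%N) j0 (m : M) :
  m != 0 -> F j0 m -> exists2 C, (0 < C)%N & forall N,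
  has_indep (F (C * N.+1)%N : set MK) (N.+1 ^ rk).
Proof.
move=> m0 Fm.
pose P := (a.+1 * b.+1)%N; pose Cw := (1 + rk * 2 + 2 * (rk.+1 * P))%N.
exists (j0 + 1 + rk.+1 * P + Cw * (P + (a + b) + 4) + (rk + rk))%N => [|N].
  by rewrite addn_gt0 orbC addn_gt0.
set J' := (_ * N.+1)%N.
pose n := (rk * N)%N; pose w := (1 + n * 2 + 2 * (n.+1 * P))%N.
pose J := (j0 + 1 + n.+1 * P + w * (P + (a + b) + 4))%N.
have le_J : (J + (n + n) <= J')%N by apply: linear_bound.
apply: contrapT => nJ'.
have nJ : ~ has_indep (F J : set MK) (N.+1 ^ rk).
  move=> [u [uF uI]]; apply: nJ'; exists u; split=> // i.
  apply: (ascending_leq F_le _ (uF i)).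
  exact: leq_trans (leq_addr _ _) le_J.
pose X := ({ffun I -> 'I_N.+1} * {ffun I -> 'I_N.+1})%type.
have cardX : #|{: X}| = (N.+1 ^ rk * N.+1 ^ rk)%N.
  by rewrite card_prod !card_ffun card_sum !card_ord.
have [||x v Fv|c [[x0 cx0] killJ]] := @operator_pigeonhole K MK (F J) (F J')
  (N.+1 ^ rk) X (fun x v => ray_op K x *: (v : M)) nJ nJ'.
- by rewrite cardX.
- move=> x k u v; rewrite scalerDr; congr (_ + _).
  have comm_k : ray_op K x * k%:A = k%:A * ray_op K x :> D.
    by rewrite mulr_algl mulr_algr.
  have := congr1 (fun d : D => d *: (u : M)) comm_k; rewrite -!scalerA.
  exact.

- exact: ascending_leq F_le le_J (raises_ray_op x Fv).
pose d : D := \sum_x c x *: ray_op K x.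
have d0 : d != 0.
  by apply: contra_neq cx0 => /(ray_op_free charK0); apply.
have d_le : diffop_le n d.
  apply: diffop_le_sum => x.
  have := diffop_le_lin (c x) (ray_op_le _ x) (diffop_le0 _ _ _ _).
  by apply: eq_diffop_le => r; rewrite addr0.
have gd : grows (n * 2) d.
  by apply: grows_sum => x; apply/growsZ/grows_ray_op.
have kd : kills F J 0 d.
  move=> i v; rewrite addn0 => iJ /(ascending_leq F_le iJ)/killJ sum0.
  rewrite -[RHS]sum0 scaler_suml; apply: eq_bigr => x _.
  by rewrite -mulr_algl -scalerA.
exact: (annihilator_bound charK0 F_le F_add FX FEx FEy FV a_ge1 b_ge1 d0 d_le
  gd kd m0 Fm).
Qed.

End Growth.

(** * The Bernstein filtration *)

Section LinearSpan.
Variables (K : fieldType) (V : lmodType K) (S : set V).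

Lemma lspan_sub x : S x -> lspan S x.
Proof.
by move=> Sx; exists 1%N, (fun=> 1), (fun=> x); rewrite big_ord1 scale1r.
Qed.

Lemma lspan0 : lspan S 0.
Proof. by exists 0%N, (fun=> 0), (fun=> 0); split; [case|rewrite big_ord0]. Qed.

Lemma lspan_lin c x y : lspan S x -> lspan S y -> lspan S (c *: x + y).
Proof.
move=> [n [cx [ux [Sx ->]]]] [m [cy [uy [Sy ->]]]].
exists (n + m)%N,
  (fun i => match fintype.split i with
            | inl j => c * cx j | inr j => cy j end),
  (fun i => match fintype.split i with inl j => ux j | inr j => uy j end); split.
  by move=> i; case: fintype.split.
rewrite big_split_ord /= scaler_sumr; congr (_ + _); apply: eq_bigr => i _.
  by rewrite (unsplitK (inl i)) scalerA.
by rewrite (unsplitK (inr i)).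
Qed.

Lemma lspanD x y : lspan S x -> lspan S y -> lspan S (x + y).
Proof. by move=> Sx Sy; rewrite -[x]scale1r; apply: lspan_lin. Qed.

Lemma lspan_ind (P : V -> Prop) : P 0 ->
  (forall c x y, P x -> P y -> P (c *: x + y)) -> (forall x, S x -> P x) ->
  forall x, lspan S x -> P x.
Proof.
move=> P0 PL PS x [n [c [u [uS ->]]]].
apply: (big_ind P) => //.
  by move=> y z Py Pz; rewrite -[y]scale1r; apply: PL.
by move=> i _; rewrite -[_ *: _]addr0; apply: PL => //; apply: PS.
Qed.

End LinearSpan.

Section BernsteinGenerators.
Variables (K : fieldType) (a b : nat).
Local Notation R := (segre_ring K a b).
Local Notation D := (diffop R).
Local Notation G := (@segre_grading K a b).

Lemma grading_mul n i j r : G n r -> G n.+1 (segre_gen K i j * r).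
Proof.
move: r; apply: lspan_ind => [|c x y Gx Gy|r [s ->]].
- by rewrite mulr0; apply: lspan0.
- by rewrite mulrDr -scalerAr; apply: lspan_lin.
- apply: lspan_sub.
  exists (fun k => if unlift ord0 k is Some k' then s k' else (i, j)).
  rewrite big_ord_recl unlift_none; congr (_ * _).
  by apply: eq_bigr => k _; rewrite liftK.
Qed.

Lemma grading_ind (P : nat -> R -> Prop) :
  (forall n, P n 0) -> P 0 1 ->
  (forall n c x y, P n x -> P n y -> P n (c *: x + y)) ->
  (forall n i j r, G n r -> P n r -> P n.+1 (segre_gen K i j * r)) ->
  forall n r, G n r -> P n r.
Proof.
move=> P0 P1 PL PM n; apply: lspan_ind => // [c x y|r [s ->]]; first exact: PL.
elim: n s => [|n IHn] s; first by rewrite big_ord0.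
rewrite big_ord_recl; apply: PM => //.
by apply: lspan_sub; exists (fun k => s (lift ord0 k)).
Qed.

Lemma opX_homog k l : diffop_homog G 1 (opX K k l).
Proof.
move=> j r Gr; rewrite -[int_piece _ _]/(G (j + 1)%N) addn1.
have -> : opX K k l r = segre_gen K k l * r by apply: val_inj.
exact: grading_mul.
Qed.

Lemma bool_grading (c : bool) n r : G n r -> G n (c%:R * r).
Proof. by case: c; rewrite ?mul1r ?mul0r // => _; apply: lspan0. Qed.

Lemma derivation_homog (d : D) : derivation d ->
  (forall i j, exists (c : bool) i' j',
    d (segre_gen K i j) = c%:R * segre_gen K i' j') ->
  diffop_homog G 0 d.
Proof.
move=> dd dg j r Gr; rewrite -[int_piece _ _]/(G (j + 0)%N) addn0.
move: j r Gr; apply: grading_ind => [n||n c x y Gx Gy|n i j r Gr Gdr].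
- by rewrite diffop0; apply: lspan0.
- by rewrite derivation1 //; apply: lspan0.
- by rewrite (diffop_linear d); apply: lspan_lin.
- rewrite dd; apply: lspanD; last exact: grading_mul.
  have [c [i' [j' ->]]] := dg i j; rewrite -mulrA.
  by apply/bool_grading/grading_mul.
Qed.

Lemma opEx_homog (k m : 'I_a.+1) : diffop_homog G 0 (opEx K b k m).
Proof.
apply: derivation_homog; first exact: opEx_derivation.
by move=> i j; exists (m == i), k, j; apply: opEx_gen.
Qed.

Lemma opEy_homog (k m : 'I_b.+1) : diffop_homog G 0 (opEy K a k m).
Proof.
apply: derivation_homog; first exact: opEy_derivation.
by move=> i j; exists (m == j), i, k; apply: opEy_gen.
Qed.

(** In degree 0 the target piece is zero, so that case is separated throughout the induction. *)
Lemma opV_homog k l : diffop_homog G (-1) (opV K k l).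
Proof.
have pieceS n : int_piece G (n.+1%:Z + -1) = G n.
  by rewrite -addn1 PoszD addrK.
move=> n; move: n; apply: grading_ind => [n||n c x y Px Py|n i j r Gr Pr].
- rewrite diffop0; case: n => [//|n]; rewrite pieceS; exact: lspan0.
- by apply: val_inj; rewrite /= /dxy mderivC mderiv0.
- rewrite (diffop_linear (opV K k l)); case: n Px Py => [|n].
    by move=> -> ->; rewrite scaler0 addr0.
  by rewrite !pieceS; apply: lspan_lin.
- rewrite pieceS.
  have -> : opV K k l (segre_gen K i j * r) =
      (k == i)%:R * ((l == j)%:R * r) + (k == i)%:R * opEy K a j l r +
      (l == j)%:R * opEx K b i k r + segre_gen K i j * opV K k l r.
    by apply: val_inj; rewrite /= dxy_mon !segre_natr.
  apply: lspanD; last first.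
    by case: n Gr Pr => [_ ->|n _]; [rewrite mulr0; apply: lspan0 |
      rewrite pieceS; apply: grading_mul].
  have GE : G n (opEx K b i k r).
    by have := opEx_homog i k Gr; rewrite -[int_piece _ _]/(G (n + 0)%N) addn0.
  have GE' : G n (opEy K a j l r).
    by have := opEy_homog j l Gr; rewrite -[int_piece _ _]/(G (n + 0)%N) addn0.
  by do 2?[apply: lspanD];
    do ![exact: Gr | exact: GE | exact: GE' | apply: bool_grading].
Qed.

(** The index bounds deg + w ord for degree at most 1 and order at most 2, whatever the sign of
    [w]. *)
Lemma bernstein_gen (w : int) (deg : int) (d : D) :
  diffop_homog G deg d -> deg <= 1 -> diffop_le 2 d ->
  bernstein G w (1 + 2 * `|w|)%N d.
Proof.
move=> hd deg1 d2; apply: lspan_sub; exists deg; split=> //.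
have ord2 : (diffop_ord d <= 2)%N.
  by rewrite /diffop_ord; case: ex_minnP => m _; apply; apply/asboolP.
by case: (diffop_ord d) ord2 => [|[|[|//]]] _; lia.
Qed.

End BernsteinGenerators.

Section ModuleDimension.
Variable RR : realType.

Lemma edim_ge (K : fieldType) (V : lmodType K) (W : set V) n :
  has_indep W n -> (n%:R%:E <= edim RR W)%E.
Proof. by move=> Wn; apply: ereal_sup_ubound; exists n. Qed.

(** If t < d, then along n = C(N+1) the quotient is at least C^(-t) (N+1)^(d-t), hence at least
    C^(-t), and cannot tend to 0. *)
Lemma growth_exponent (K : fieldType) (V : lmodType K) (F : nat -> set V)
    C d t :
  (0 < C)%N -> (forall N, has_indep (F (C * N.+1)%N) (N.+1 ^ d)) ->
  (fun n : nat => edim RR (F n) * ((n%:R `^ t : RR)^-1)%:E)%E @ \oo --> 0%E ->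
  d%:R <= t.
Proof.
move=> C0 WF cvg0; rewrite leNgt; apply/negP => lt_td.
have pow_gt0 (n : nat) : (0 < n)%N -> 0 < (n%:R : RR) `^ t.
  by move=> n0; apply: powR_gt0; rewrite ltr0n.
have eps : 0 < ((C%:R : RR) `^ t)^-1 by rewrite invr_gt0; apply: pow_gt0.
have [N0 _ H] := cvg0 _
  (nbhs_open_ereal_lt (f := fun=> ((C%:R : RR) `^ t)^-1) eps).
have /= := H (C * N0.+1)%N (leq_trans (leqnSn _) (leq_pmull _ C0)).
apply/negP; rewrite -leNgt; apply: (@le_trans _ _
  ((N0.+1 ^ d)%:R%:E * (((C * N0.+1)%:R `^ t)^-1)%:E)%E); last first.
  by apply: lee_wpmul2r; [rewrite lee_fin invr_ge0 powR_ge0 | apply: edim_ge].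
rewrite -EFinM lee_fin natrM powRM ?ler0n // invfM mulrCA.
rewrite -[leLHS]mulr1 ler_wpM2l ?invr_ge0 ?powR_ge0 //.
rewrite ler_pdivlMr ?pow_gt0 // mul1r natrX -powR_mulrn ?ler0n //.
by apply: ler_powR; [rewrite ler1n | apply: ltW].
Qed.

Lemma module_dim_ge (K : fieldType) (a b : nat) (w : int)
    (charK0 : [pchar K] =i pred0) (a_ge1 : (0 < a)%N) (b_ge1 : (0 < b)%N)
    (M : lmodType (diffop (segre_ring K a b))) :
  (exists m : M, m != 0) ->
  ((a.+1 + b)%:R%:E <=
    module_dim RR (bernstein (segre_grading (K := K) (a := a) (b := b)) w) M)%E.
Proof.
move=> [m m0]; apply: le_ereal_inf_tmp => _ [F [Fsub Fle Fex FB] <-].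
apply: le_ereal_inf_tmp => _ [t [t0 cvg0] <-]; rewrite lee_fin.
pose c0 := (1 + 2 * `|w|)%N.
(* Reindexing by [c0] makes each generator raise the filtration by one step; it only changes the
   constant in the growth bound. *)
pose F' n := F (c0 * n)%N.
have gen deg d : diffop_homog (segre_grading (K:=K) (a:=a) (b:=b)) deg d ->
    deg <= 1 -> diffop_le 2 d -> raises F' d.
  move=> hd deg1 d2 n x; rewrite /F' mulnS => Fx.
  by apply: FB Fx; apply: bernstein_gen hd deg1 d2.
have [j0 Fm] := Fex m.
have Fm' : F' j0 m by apply: ascending_leq Fle _ Fm; apply: leq_pmull.
have F'_le n x : F' n x -> F' n.+1 x.
  by apply: (ascending_leq Fle); rewrite leq_mul2l leqnSn orbT.
have FX k l : raises F' (opX K k l).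
  exact: gen (opX_homog k l) isT (diffop_le_leq (leq0n 2) (opM_le _)).
have FEx k l : raises F' (opEx K b k l).
  exact: gen (opEx_homog k l) isT (diffop_le_leq (leqnSn 1) (opEx_le _ _ _ _)).
have FEy k l : raises F' (opEy K a k l).
  exact: gen (opEy_homog k l) isT (diffop_le_leq (leqnSn 1) (opEy_le _ _ _ _)).
have FV k l : raises F' (opV K k l).
  exact: gen (opV_homog k l) isT (opV_le _ _ _).
have [C C0 FC] := growth charK0 F'_le (fun n => Fsub _) FX FEx FEy FV
  a_ge1 b_ge1 m0 Fm'.
apply: (@growth_exponent _ (restr_scalars M) F (c0 * C)) cvg0; last first.
  by move=> N; rewrite -mulnA; apply: (FC N).
by rewrite muln_gt0.
Qed.

End ModuleDimension.

(** * Krull dimension *)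

Section PrimeChains.
Variables (K : fieldType) (A : comAlgType K).

(* [multi_sum N n f c] is the value at [f 0, ..., f n.-1] of the polynomial
   of degree less than [N] in each of its [n] variables with coefficients [c],
   the exponents being listed in a sequence. *)
Fixpoint multi_sum N n (f : nat -> A) (c : seq nat -> K) : A :=
  if n is n'.+1 then
    \sum_(i < N) f 0 ^+ i *
      multi_sum N n' (fun k => f k.+1) (fun s => c (nat_of_ord i :: s))
  else (c [::])%:A.

Lemma multi_sum_lin N n f k c c' :
  multi_sum N n f (fun s => k * c s + c' s) =
  k *: multi_sum N n f c + multi_sum N n f c'.
Proof.
elim: n f c c' => [|n IHn] f c c' /=; first by rewrite scalerDl scalerA.
rewrite scaler_sumr -big_split /=; apply: eq_bigr => i _.
by rewrite (IHn _ (fun s => c (_ :: s))) mulrDr scalerAr.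
Qed.

Lemma multi_sum0 N n f c :
  (forall s, size s = n -> all (ltn^~ N) s -> c s = 0) -> multi_sum N n f c = 0.
Proof.
elim: n f c => [|n IHn] f c c0 /=; first by rewrite c0 ?scale0r.
rewrite big1 // => i _; rewrite IHn ?mulr0 // => s sn sN.
by apply: c0; rewrite /= ?sn // ltn_ord.
Qed.

Lemma multi_sum_sum N n f (X : Type) (s : seq X) (k : X -> K)
    (c : X -> seq nat -> K) :
  multi_sum N n f (fun t => \sum_(x <- s) k x * c x t) =
  \sum_(x <- s) k x *: multi_sum N n f (c x).
Proof.
elim: s => [|x s IHs].
  by rewrite big_nil; apply: multi_sum0 => t _ _; rewrite big_nil.
rewrite big_cons -IHs -multi_sum_lin; congr multi_sum.
by apply/funext => t; rewrite big_cons.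
Qed.

(** Modulo P' only h_0 remains, so h_0 lies in P' and is zero; then f, which is not in the prime P,
    can be cancelled from the rest of the sum. *)
Lemma ideal_power_sum (P P' : {pred A}) N (f : A) (h : nat -> A) :
  prime_ideal P -> prime_ideal P' -> {subset P <= P'} ->
  f \in P' -> f \notin P -> (forall i, (i < N)%N -> h i \in P' -> h i = 0) ->
  \sum_(i < N) f ^+ i * h i \in P -> forall i, (i < N)%N -> h i \in P'.
Proof.
move=> [[P0 P1 PD] Ppr] [[P'0 P'1 P'D] P'pr] sPP' fP' fP.
elim: N h => // N IHN h h0 sumP.
have sumE : \sum_(i < N.+1) f ^+ i * h i =
    h 0%N + f * \sum_(i < N) f ^+ i * h i.+1.
  rewrite big_ord_recl mul1r mulr_sumr; congr (_ + _).
  by apply: eq_bigr => i _; rewrite exprS mulrA.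
have h0P' : h 0%N \in P'.
  have := P'D (- \sum_(i < N) f ^+ i * h i.+1) _ _ fP' (sPP' _ sumP).
  by rewrite sumE mulNr [X in - X]mulrC addrCA addNr addr0.
have h00 : h 0%N = 0 by apply: h0.
move: sumP; rewrite sumE h00 add0r => /Ppr; rewrite (negPf fP) /= => sumP.
case=> [//|i]; rewrite ltnS; apply: (IHN (fun i => h i.+1)) => // k kN.
exact: (h0 k.+1).
Qed.

(* Successive elements of the gaps of a chain of primes are algebraically
   independent: modulo the next prime only the lowest power of the first of
   them survives. *)
Lemma prime_chain_independent N n (P : nat -> {pred A}) f c :
  (forall i, (i <= n)%N -> prime_ideal (P i)) ->
  (forall i, (i < n)%N -> {subset P i <= P i.+1}) ->
  (forall i, (i < n)%N -> f i \in P i.+1) ->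
  (forall i, (i < n)%N -> f i \notin P i) ->
  multi_sum N n f c \in P 0%N ->
  forall s, size s = n -> all (ltn^~ N) s -> c s = 0.
Proof.
elim: n P f c => [|n IHn] P f c Pprime Psub fP fnP sumP s.
  have [[P0 P1 PD] _] := Pprime 0%N isT.
  case: s => // _ _; apply/eqP; apply: contraNT P1 => c0.
  have := PD ((c [::])^-1)%:A _ _ sumP P0.
  by rewrite addr0 -scalerAl mul1r scalerA mulVf // scale1r.
pose h i := multi_sum N n (fun k => f k.+1) (fun s => c (i :: s)).
have IHh i : h i \in P 1%N ->
    forall s, size s = n -> all (ltn^~ N) s -> c (i :: s) = 0.
  apply: (IHn (fun k => P k.+1) (fun k => f k.+1)) => k kn.
  - exact: Pprime.
  - exact: Psub.
  - exact: fP.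
  - exact: fnP.
case: s => // i s [sn] /= /andP[iN sN]; apply: (IHh i) => //.
(* A coefficient [h k] lying in [P 1] has all its own coefficients zero by induction, hence is zero,
   as [ideal_power_sum] requires. *)
apply: (ideal_power_sum (Pprime 0%N isT) (Pprime 1%N isT) (Psub 0%N isT)
  (fP 0%N isT) (fnP 0%N isT) _ sumP) => // k kN hk.
by apply: multi_sum0; apply: (IHh k).
Qed.

End PrimeChains.

Section SegreKrull.
Variables (RR : realType) (K : fieldType) (a b : nat).
Local Notation R := (segre_ring K a b).
Local Notation S := {mpoly K[a.+1 + b.+1]}.
Local Notation I := ('I_a.+1 + 'I_b)%type.
Local Notation rk := (a.+1 + b)%N.
Local Notation ix := (@lshift a.+1 b.+1).
Local Notation iy := (@rshift a.+1 b.+1).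

(* A balanced exponent is determined by all its entries but that of [y_0]. *)
Definition balanced_mnm (c : I -> nat) : 'X_{1..a.+1 + b.+1} :=
  [multinom match fintype.split i with
    | inl k => c (inl k)
    | inr l => if unlift ord0 l is Some l' then c (inr l')
               else (\sum_k c (inl k) - \sum_l' c (inr l'))%N
    end | i < a.+1 + b.+1].

Lemma balanced_mnmP (r : R) m : m \in msupp (segre_val r) ->
  m = balanced_mnm (fun i => match i with
    | inl k => m (ix k) | inr l => m (iy (lift ord0 l)) end).
Proof.
move=> mr; apply/mnmP => i; rewrite mnmE; case: (split_ordP i) => j -> //.
case: (unliftP ord0 j) => [l ->|->] //.
by rewrite (segre_balanced (segre_valP r) mr) big_ord_recl addnK.
Qed.

(** The bound on the Hilbert function: (E+1)^rk coefficients determine an element of degree at most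
    E. *)
Lemma segre_coef0 E (r : R) : (msize (segre_val r) <= E.+1)%N ->
  (forall c : {ffun I -> 'I_E.+1},
    (segre_val r)@_(balanced_mnm (fun i => c i)) = 0) ->
  r = 0.
Proof.
move=> rE coef0; apply: val_inj; apply/mpolyP => m; rewrite mcoeff0.
apply/eqP; rewrite mcoeff_eq0; apply/negP => mr.
have mE i : (m i < E.+1)%N.
  apply: leq_trans (leq_trans (msize_mdeg_lt mr) rE).
  by rewrite ltnS mdegE (bigD1 i) //= leq_addr.
pose c : {ffun I -> 'I_E.+1} := [ffun i => match i with
  | inl k => Ordinal (mE (ix k))
  | inr l => Ordinal (mE (iy (lift ord0 l))) end].
have := coef0 c; apply/eqP; rewrite -mcoeff_msupp.
rewrite (_ : balanced_mnm _ = m) //; rewrite [RHS](balanced_mnmP mr).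
by congr balanced_mnm; apply/funext => -[k|l]; rewrite ffunE.
Qed.

Lemma msize_multi_sum e N n (f : nat -> R) c :
  (forall i, (i < n)%N -> (msize (segre_val (f i)) <= e.+1)%N) ->
  (msize (segre_val (multi_sum N n f c)) <= (n * (N * e)).+1)%N.
Proof.
have leM (p q : S) k l : (msize p <= k.+1)%N -> (msize q <= l.+1)%N ->
    (msize (p * q) <= (k + l).+1)%N.
  move=> pk ql; apply: leq_trans (msizeM_leq _ _) _.
  by move: (mmeasure _ p) (mmeasure _ q) pk ql => u v; lia.
have valM (x y : R) : segre_val (x * y) = segre_val x * segre_val y by [].
elim: n f c => [|n IHn] f c fe /=.
  by apply: leq_trans (msizeZ_le _ _) _; rewrite msize1.
rewrite segre_val_sum; apply: leq_trans (mmeasure_sum _ _ _ _) _.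
apply/bigmax_leqP => i _; rewrite mulSn valM; apply: (@leM _ _); last first.
  by apply: IHn => k kn; apply: fe.
apply: (@leq_trans (i * e).+1); last by rewrite ltnS leq_mul2r ltnW ?orbT.
elim: (nat_of_ord i) => [|j IHj]; first by rewrite expr0 msize1.
by rewrite exprS mulSn valM; apply: (@leM _ _) => //; apply: fe.
Qed.

Lemma krull_dim_le : (krull_dim RR R <= (a.+1 + b)%:R%:E)%E.
Proof.
apply: ge_ereal_sup => _ [n [P [Pprime Pgap]] <-].
rewrite lee_fin ler_nat leqNgt; apply/negP => lt_rk.
have gapP i : exists f : R, (i < n)%N -> f \in P i.+1 /\ f \notin P i.
  have [lt_in|_] := ltnP i n; last by exists 0.
  have [_ nsub] := Pgap i lt_in; apply: contrapT => nf; apply: nsub => f fP.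
  by apply: contrapT => /negP nfP; apply: nf; exists f.
have [f fP] := choice gapP.
pose e := (\max_(i < n) msize (segre_val (f i)))%N.
have fe i : (i < n)%N -> (msize (segre_val (f i)) <= e.+1)%N.
  move=> lt_in; apply: leqW.
  pose F (i : 'I_n) := msize (segre_val (f i)).
  exact: (leq_bigmax (F := F) (Ordinal lt_in)).
(* There are N^n, so at least N^(rk+1), monomials in the [f i], against (E+1)^rk coefficients. As
   E+1 is at most N(ne+1), it suffices that N exceed (ne+1)^rk. *)
pose N := ((n * e).+1 ^ rk).+1; pose E := (n * (N * e))%N.
have cardE : (#|{: {ffun I -> 'I_E.+1}}| < #|{: n.-tuple 'I_N}|)%N.
  rewrite card_ffun card_tuple card_sum !card_ord.
  apply: (@leq_trans (N ^ rk.+1)); last by rewrite leq_pexp2l.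
  apply: (@leq_ltn_trans (N ^ rk * (n * e).+1 ^ rk)); last first.
    by rewrite expnSr ltn_pmul2l ?expn_gt0.
  by rewrite -expnMn leq_exp2r // mulnS mulnCA -add1n leq_add.
(* The monomial in the [f i] with exponents [l], obtained from an indicator function as
   coefficients. *)
pose T (l : n.-tuple 'I_N) : R :=
  multi_sum N n f (fun s => (s == map val (val l))%:R).
have [k [[l0 kl0] ksum]] := linear_dependence
  (fun l (c : {ffun I -> 'I_E.+1}) =>
    (segre_val (T l))@_(balanced_mnm (fun i => c i))) cardE.
pose c s := \sum_l k l * (s == map val (val l))%:R.
have sumT : multi_sum N n f c = \sum_l k l *: T l.
  exact: (multi_sum_sum N n f (index_enum _) k
    (fun l s => (s == map val (val l))%:R)).
have sum0 : multi_sum N n f c = 0.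
  apply: (segre_coef0 (msize_multi_sum _ _ fe)) => d; rewrite sumT.
  rewrite -[RHS](ksum d).
  apply: (big_rec2 (fun (r : R) y =>
    (segre_val r)@_(balanced_mnm (fun i => d i)) = y)).
    by rewrite mcoeff0.
  by move=> l y r _ <-; rewrite -mcoeffZ -mcoeffD.
have [[P0 _ _] _] := Pprime 0%N isT.
have := prime_chain_independent (N := N) (c := c) Pprime
  (fun i hi => (Pgap i hi).1)
  (fun i hi => (fP i hi).1) (fun i hi => (fP i hi).2).
rewrite sum0 => /(_ P0 (map val (val l0))).
rewrite size_map size_tuple all_map => /(_ erefl) c0.
case/eqP: kl0; rewrite -[RHS]c0; last by apply/allP => i _; apply: ltn_ord.
rewrite /c (bigD1 l0) //= eqxx mulr1 big1 ?addr0 // => l ll0.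
rewrite (inj_eq (inj_map val_inj)) -[_ == _]/(l0 == l).
by rewrite eq_sym (negPf ll0) mulr0.
Qed.

End SegreKrull.

Theorem theorem1p2 (RR : realType) (K : fieldType) (a b : nat)
    (charK0 : [pchar K] =i pred0) (a_ge1 : (1 <= a)%N) (b_ge1 : (1 <= b)%N)
    (B : nat -> set (diffop (segre_ring K a b)))
    (B_bernstein : bernstein_filtration (segre_grading (K := K) (a := a) (b := b)) B)
    (M : lmodType (diffop (segre_ring K a b)))
    (M_neq0 : exists m : M, m != 0) :
  (krull_dim RR (segre_ring K a b) <= module_dim RR B M)%E.
Proof.
case: B_bernstein => w [_ ->].
apply: (le_trans (krull_dim_le RR K a b)).
exact: module_dim_ge.
Qed.
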